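(* Assume the grading is strong. Let $\underline C_{k-1}$ be a quotient-up-component in dimension $k-1$ that is neither a leaf nor coherent, and let $\underline C_k=\{\underline u\in\underline X_k:\underline u\supset\underline t\text{ for some }\underline t\in\underline C_{k-1}\}$ be the corresponding quotient-down-component (neither a root nor coherent). Then $1$ is an eigenvalue of $A^{\underline C_{k-1},\mathrm{up}}_{k-1}$ and of $A^{\underline C_k,\mathrm{down}}_k$ with multiplicity one, so that their second largest eigenvalues coincide and are $<1$; the smallest eigenvalue of $A^{\mathcal O(\underline C_{k-1}),\mathrm{up}}_{k-1}$ coincides with that of $A^{\mathcal O(\underline C_k),\mathrm{down}}_k$ and is $>-1$. Finally, the up-walk on $C_{k-1}=\{t:\underline t\in\underline C_{k-1}\}$ and the down-walk on $C_k=\{u:\underline u\in\underline C_k\}$ are irreducible and aperiodic and have the same convergence rate \[ \max\Big(\lambda_{\max-1}\big(A^{\underline C_{k-1},\mathrm{up}}_{k-1}\big),\;-\lambda_{\min}\big(A^{\mathcal O(\underline C_{k-1}),\mathrm{up}}_{k-1}\big)\Big). \]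
   Context: A double cover of a graded signed graph is $\Gamma=(X,E,[\cdot:\cdot],\dim,-)$: $X$ finite nonempty, $E$ directed edges ($u\subset v$), signature $[v:u]\in\{\pm1\}$, $\dim:X\to\mathbb Z$, $-$ a fixed-point-free involution, with $u\subset v\Rightarrow\dim u<\dim v$, $-u\subset v$, $u\subset-v$, $[-v:u]=[v:-u]=-[v:u]$, and $\dim(-u)=\dim u$. Strong grading: $u\subset v\Rightarrow\dim v=\dim u+1$. Quotient $\underline\Gamma$: nodes $\underline u=\{u,-u\}$, edges $\underline u\subset\underline v$ iff $u\subset v$. Leaf: no $\underline v\supset\underline u$; root: no $\underline t\subset\underline u$. $\mathrm{LP}=1$ on leaves, $\sum_{\underline v\supset\underline u}\mathrm{LP}(\underline v)$ otherwise; $\mathrm{RP}=1$ on roots, $\sum_{\underline t\subset\underline u}\mathrm{RP}(\underline t)$ otherwise; $H=\mathrm{LP}/\mathrm{RP}$. Orientation: $\mathcal O(\underline u)\in\{u,-u\}$. Up-adjacency: distinct nodes of dimension $k$ below a common node of dimension $k+1$; down-adjacency: distinct nodes of dimension $k$ above a common node of dimension $k-1$; quotient-up-(down-)components in dimension $k$: maximal up-(down-)connected subsets of $\underline X_k$. Coherent: a quotient-up-component $\underline C$ in dimension $j$, not a single leaf, with an orientation such that $[v:u]=[v:u']$ for all $u,u'\in\mathcal O(\underline C)$, $v\supset u,u'$; a quotient-down-component, not a single root, with an orientation such that $[u:t]=[u':t]$ for all $u,u'\in\mathcal O(\underline C)$, $t\subset u,u'$. Matrices on $\underline X_k$: $(A^{\underline\Gamma,\mathrm{up}}_k)_{\underline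 u\underline u'}=H(\underline u)^{-1/2}H(\underline u')^{-1/2}\sum_{\underline v\supset\underline u,\underline u'}H(\underline v)$ if up-adjacent or $\underline u=\underline u'$ non-leaf, $1$ if $\underline u=\underline u'$ leaf, $0$ otherwise; $(A^{\underline\Gamma,\mathrm{down}}_k)_{\underline u\underline u'}=H(\underline u)^{1/2}H(\underline u')^{1/2}\sum_{\underline t\subset\underline u,\underline u'}H(\underline t)^{-1}$ if down-adjacent or $\underline u=\underline u'$ non-root, $1$ if $\underline u=\underline u'$ root, $0$ otherwise. Signed versions on $\mathcal O(\underline X_k)$: $(A^{\mathcal O,\mathrm{up}}_k)_{uu'}=-H(\underline u)^{-1/2}H(\underline u')^{-1/2}\sum_{\underline v\supset\underline u,\underline u'}[v:u][v:u']H(\underline v)$ if up-adjacent or $\underline u=\underline u'$ non-leaf, else $0$; $(A^{\mathcal O,\mathrm{down}}_k)_{uu'}=-H(\underline u)^{1/2}H(\underline u')^{1/2}\sum_{\underline t\subset\underline u,\underline u'}[u:t][u':t]H(\underline t)^{-1}$ if down-adjacent or $\underline u=\underline u'$ non-root, else $0$ ($v=\mathcal O(\underline v)$, $t=\mathcal O(\underline t)$). Superscripts $\underline C$ / $\mathcal O(\underline C)$ denote principal submatrices indexed by the component. $\lambda_{\max-1}$ is the second largest eigenvalue, $\lambda_{\min}$ the smallest. Walks: up-walk on $X_k$: for $\underline u$ not a leaf, $P(u,u')=\sum\frac{\mathrm{LP}(\underline v)\mathrm{RP}(\underline u')}{\mathrm{LP}(\underline u)\mathrm{RP}(\underline v)}$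 over $v\in X$ with $v\supset u,u'$, $[v:u]=1$, $[v:u']=-1$; for leaves $P(u,\pm u)=1/2$. Down-walk: for $\underline u$ not a root, $P(u,u')=\sum\frac{\mathrm{RP}(\underline t)\mathrm{LP}(\underline u')}{\mathrm{RP}(\underline u)\mathrm{LP}(\underline t)}$ over $t\subset u,u'$, $[u:t]=-1$, $[u':t]=1$; for roots $P(u,\pm u)=1/2$. The convergence rate of a chain on a set is the $\lambda\in(0,1)$ such that for almost every initial distribution there the total variation distance to the stationary distribution at time $t$ is asymptotic, up to a constant, to $\lambda^t$. *)

(* Defs.v *)
From HB Require Import structures.
From mathcomp Require Import all_boot all_order all_algebra.
From mathcomp Require Import all_classical all_reals all_analysis.
From mathcomp.real_closed Require polyrcf.

Set Implicit Arguments.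
Unset Strict Implicit.
Unset Printing Implicit Defensive.

Import Order.TTheory GRing.Theory Num.Theory.
Import numFieldNormedType.Exports.

Local Open Scope ring_scope.

(* [dc_edge u v] is the edge u ⊂ v and [dc_sign v u] is the signature [v:u]. The
   signature is total but is constrained, and used below, only on edges. *)
Record double_cover := DoubleCover {
  dc_node :> finType;
  dc_edge : rel dc_node;
  dc_sign : dc_node -> dc_node -> int;
  dc_dim : dc_node -> int;
  dc_opp : dc_node -> dc_node;
  dc_nonempty : (0 < #|dc_node|)%N;
  dc_oppK : involutive dc_opp;
  dc_opp_neq : forall u, dc_opp u != u;
  dc_dim_lt : forall u v, dc_edge u v -> dc_dim u < dc_dim v;
  dc_sign_pm1 : forall u v, dc_edge u v -> dc_sign v u = 1 \/ dc_sign v u = -1;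
  dc_edge_oppl : forall u v, dc_edge u v -> dc_edge (dc_opp u) v;
  dc_edge_oppr : forall u v, dc_edge u v -> dc_edge u (dc_opp v);
  dc_sign_oppl : forall u v, dc_edge u v ->
    dc_sign (dc_opp v) u = - dc_sign v u;
  dc_sign_oppr : forall u v, dc_edge u v ->
    dc_sign v (dc_opp u) = - dc_sign v u;
  dc_dim_opp : forall u, dc_dim (dc_opp u) = dc_dim u
}.

Definition strong_grading (G : double_cover) :=
  forall u v : G, dc_edge u v -> dc_dim v = dc_dim u + 1.

Definition opp_pair (G : double_cover) (u : G) : {set G} := [set u; dc_opp u].

Definition qnode (G : double_cover) :=
  {a : {set G} | a \in [set opp_pair u | u : G]}.

Lemma opp_pair_qnode (G : double_cover) (u : G) :
  opp_pair u \in [set opp_pair w | w : G].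
Proof. exact: imset_f. Qed.

Definition qn (G : double_cover) (u : G) : qnode G :=
  exist _ (opp_pair u) (opp_pair_qnode u).

Definition qedge (G : double_cover) : rel (qnode G) :=
  fun a b => [exists u in val a, exists v in val b, dc_edge u v].

Lemma qnode_inhabited (G : double_cover) (a : qnode G) : exists u, u \in val a.
Proof. by case: a => a /= /imsetP[u _ ->]; exists u; rewrite !inE eqxx. Qed.

Definition qdim (G : double_cover) (a : qnode G) : int :=
  dc_dim (xchoose (qnode_inhabited a)).

Lemma mem_qn (G : double_cover) (u w : G) :
  (w \in val (qn u)) = (w == u) || (w == dc_opp u).
Proof. by rewrite !inE. Qed.

Lemma qn_opp (G : double_cover) (u : G) : qn (dc_opp u) = qn u.
Proof.
by apply: val_inj; apply/setP => w; rewrite /= !inE dc_oppK orbC.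
Qed.

Lemma qnP (G : double_cover) (a : qnode G) (u : G) : u \in val a -> a = qn u.
Proof.
case: a => a /= ha; case/imsetP: (ha) => w _ defa.
have -> : exist _ a ha = qn w by apply: val_inj.
by rewrite defa !inE => /orP[] /eqP->; rewrite ?qn_opp.
Qed.

Lemma qedge_qn (G : double_cover) (u v : G) : qedge (qn u) (qn v) = dc_edge u v.
Proof.
apply/existsP/idP => [[u' /andP[]]|uv]; last first.
  exists u; rewrite !inE eqxx; apply/existsP; exists v.
  by rewrite !inE eqxx.
rewrite mem_qn => hu /existsP[v' /andP[]]; rewrite mem_qn => hv e.
have {hu}e : dc_edge u v'.
  by case/orP: hu e => /eqP-> // /dc_edge_oppl; rewrite dc_oppK.
by case/orP: hv e => /eqP-> // /dc_edge_oppr; rewrite dc_oppK.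
Qed.

Lemma qdim_qn (G : double_cover) (u : G) : qdim (qn u) = dc_dim u.
Proof.
rewrite /qdim; move: (xchooseP (qnode_inhabited (qn u))).
by rewrite mem_qn => /orP[] /eqP->; rewrite ?dc_dim_opp.
Qed.

Lemma qedge_dim (G : double_cover) (a b : qnode G) :
  qedge a b -> qdim a < qdim b.
Proof.
case/existsP => u /andP[/qnP-> /existsP[v /andP[/qnP->]]] /dc_dim_lt.
by rewrite !qdim_qn.
Qed.

Definition qlevel (G : double_cover) (k : int) : {set qnode G} :=
  [set a | qdim a == k].

Definition qleaf (G : double_cover) (a : qnode G) : bool :=
  ~~ [exists b, qedge a b].

Definition qroot (G : double_cover) (a : qnode G) : bool :=
  ~~ [exists b, qedge b a].

(* The recursions for LP and RP are run with #|{: qnode G}| units of fuel, enough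
   since the quotient is acyclic: see [LPE] and [RPE]. *)
Fixpoint LP_rec (G : double_cover) (n : nat) (a : qnode G) : nat :=
  if n is n'.+1 then
    if qleaf a then 1%N else (\sum_(b | qedge a b) LP_rec n' b)%N
  else 1%N.

Fixpoint RP_rec (G : double_cover) (n : nat) (a : qnode G) : nat :=
  if n is n'.+1 then
    if qroot a then 1%N else (\sum_(b | qedge b a) RP_rec n' b)%N
  else 1%N.

Definition LP (G : double_cover) (a : qnode G) : nat := LP_rec #|{: qnode G}| a.
Definition RP (G : double_cover) (a : qnode G) : nat := RP_rec #|{: qnode G}| a.

Lemma LP_rec_stable (G : double_cover) (n m : nat) (a : qnode G) :
  (#|[set b : qnode G | (qdim a < qdim b)%R]| < n)%N ->
  (#|[set b : qnode G | (qdim a < qdim b)%R]| < m)%N -> LP_rec n a = LP_rec m a.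
Proof.
elim: n m a => [|n IH] [|m] a //= hn hm; case: ifP => // _.
apply: eq_bigr => b /qedge_dim ab.
have lt : (#|[set c : qnode G | (qdim b < qdim c)%R]|
           < #|[set c : qnode G | (qdim a < qdim c)%R]|)%N.
  apply/proper_card/properP; split; last by exists b; rewrite !inE ?ltxx.
  by apply/fintype.subsetP => c; rewrite !inE; apply: lt_trans.
by apply: IH; apply: leq_trans lt _.
Qed.

Lemma RP_rec_stable (G : double_cover) (n m : nat) (a : qnode G) :
  (#|[set b : qnode G | (qdim b < qdim a)%R]| < n)%N ->
  (#|[set b : qnode G | (qdim b < qdim a)%R]| < m)%N -> RP_rec n a = RP_rec m a.
Proof.
elim: n m a => [|n IH] [|m] a //= hn hm; case: ifP => // _.
apply: eq_bigr => b /qedge_dim ab.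
have lt : (#|[set c : qnode G | (qdim c < qdim b)%R]|
           < #|[set c : qnode G | (qdim c < qdim a)%R]|)%N.
  apply/proper_card/properP; split; last by exists b; rewrite !inE ?ltxx.
  by apply/fintype.subsetP => c; rewrite !inE => /lt_trans; apply.
by apply: IH; apply: leq_trans lt _.
Qed.

Lemma LPE (G : double_cover) (a : qnode G) :
  LP a = if qleaf a then 1%N else (\sum_(b | qedge a b) LP b)%N.
Proof.
have lt (c : qnode G) : (#|[set b : qnode G | (qdim c < qdim b)%R]| < #|{: qnode G}|)%N.
  rewrite -cardsT; apply/proper_card/properP; split; first exact: finset.subsetT.
  by exists c; rewrite !inE ?ltxx.
have -> : LP a = LP_rec #|{: qnode G}|.+1 a.
  by apply: LP_rec_stable; rewrite ?lt // ltnS ltnW ?lt.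
by [].
Qed.

Lemma RPE (G : double_cover) (a : qnode G) :
  RP a = if qroot a then 1%N else (\sum_(b | qedge b a) RP b)%N.
Proof.
have lt (c : qnode G) : (#|[set b : qnode G | (qdim b < qdim c)%R]| < #|{: qnode G}|)%N.
  rewrite -cardsT; apply/proper_card/properP; split; first exact: finset.subsetT.
  by exists c; rewrite !inE ?ltxx.
have -> : RP a = RP_rec #|{: qnode G}|.+1 a.
  by apply: RP_rec_stable; rewrite ?lt // ltnS ltnW ?lt.
by [].
Qed.

Definition LPRP (R : realType) (G : double_cover) (a : qnode G) : R :=
  (LP a)%:R / (RP a)%:R.

Definition orientation (G : double_cover) (O : qnode G -> G) :=
  forall a, O a \in val a.

Definition up_adj (G : double_cover) : rel (qnode G) := fun a b =>
  [&& a != b, qdim a == qdim b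
    & [exists c, [&& qdim c == qdim a + 1, qedge a c & qedge b c]]].

Definition down_adj (G : double_cover) : rel (qnode G) := fun a b =>
  [&& a != b, qdim a == qdim b
    & [exists c, [&& qdim c == qdim a - 1, qedge c a & qedge c b]]].

Definition connected_set (T : finType) (e : rel T) (C : {set T}) : bool :=
  (C != finset.set0) &&
  [forall a in C, forall b in C,
     connect [rel x y | [&& x \in C, y \in C & e x y]] a b].

Definition component (T : finType) (e : rel T) (S C : {set T}) : bool :=
  maxset (fun D : {set T} => (D \subset S) && connected_set e D) C.

Definition up_component (G : double_cover) (k : int) (C : {set qnode G}) :=
  component (@up_adj G) (qlevel G k) C.

Definition down_component (G : double_cover) (k : int) (C : {set qnode G}) :=
  component (@down_adj G) (qlevel G k) C.

Definition single_leaf (G : double_cover) (C : {set qnode G}) :=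
  exists2 a, qleaf a & C = [set a].

Definition single_root (G : double_cover) (C : {set qnode G}) :=
  exists2 a, qroot a & C = [set a].

Definition up_coherent (G : double_cover) (C : {set qnode G}) :=
  ~ single_leaf C /\
  exists2 O : qnode G -> G, orientation O &
    forall u u' v : G, u \in O @: C -> u' \in O @: C ->
      dc_edge u v -> dc_edge u' v -> dc_sign v u = dc_sign v u'.

Definition down_coherent (G : double_cover) (C : {set qnode G}) :=
  ~ single_root C /\
  exists2 O : qnode G -> G, orientation O &
    forall u u' t : G, u \in O @: C -> u' \in O @: C ->
      dc_edge t u -> dc_edge t u' -> dc_sign u t = dc_sign u' t.

Definition nodes_above (G : double_cover) (k : int) (C : {set qnode G}) :
    {set qnode G} :=
  [set a in qlevel G k | [exists t in C, qedge t a]].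

Definition lift_set (G : double_cover) (C : {set qnode G}) : {set G} :=
  [set u | qn u \in C].

Definition principal (R : realType) (T : finType) (C : {set T})
    (A : T -> T -> R) : 'M[R]_#|C| :=
  \matrix_(i, j) A (enum_val i) (enum_val j).

Definition A_up (R : realType) (G : double_cover) (a b : qnode G) : R :=
  if up_adj a b || (a == b) && ~~ qleaf a then
    (Num.sqrt (LPRP R a))^-1 * (Num.sqrt (LPRP R b))^-1
      * \sum_(c | qedge a c && qedge b c) LPRP R c
  else if (a == b) && qleaf a then 1 else 0.

Definition A_down (R : realType) (G : double_cover) (a b : qnode G) : R :=
  if down_adj a b || (a == b) && ~~ qroot a then
    Num.sqrt (LPRP R a) * Num.sqrt (LPRP R b)
      * \sum_(c | qedge c a && qedge c b) (LPRP R c)^-1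
  else if (a == b) && qroot a then 1 else 0.

Definition AO_up (R : realType) (G : double_cover) (O : qnode G -> G)
    (u u' : G) : R :=
  if up_adj (qn u) (qn u') || (qn u == qn u') && ~~ qleaf (qn u) then
    - ((Num.sqrt (LPRP R (qn u)))^-1 * (Num.sqrt (LPRP R (qn u')))^-1
      * \sum_(c | qedge (qn u) c && qedge (qn u') c)
          (dc_sign (O c) u)%:~R * (dc_sign (O c) u')%:~R * LPRP R c)
  else 0.

Definition AO_down (R : realType) (G : double_cover) (O : qnode G -> G)
    (u u' : G) : R :=
  if down_adj (qn u) (qn u') || (qn u == qn u') && ~~ qroot (qn u) then
    - (Num.sqrt (LPRP R (qn u)) * Num.sqrt (LPRP R (qn u'))
      * \sum_(c | qedge c (qn u) && qedge c (qn u'))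
          (dc_sign u (O c))%:~R * (dc_sign u' (O c))%:~R * (LPRP R c)^-1)
  else 0.

(* The real eigenvalues in nondecreasing order, each repeated according to its
   algebraic multiplicity. *)
Definition eigvals (R : realType) (n : nat) (A : 'M[R]_n) : seq R :=
  flatten [seq nseq (mup x (char_poly A)) x | x <- polyrcf.rootsR (char_poly A)].

Definition lambda_min (R : realType) (n : nat) (A : 'M[R]_n) : R :=
  nth 0 (eigvals A) 0.

Definition lambda_max1 (R : realType) (n : nat) (A : 'M[R]_n) : R :=
  nth 0 (eigvals A) (size (eigvals A)).-2.

Definition simple_eigenvalue (R : realType) (n : nat) (A : 'M[R]_n) (x : R) :=
  eigenvalue A x /\ mup x (char_poly A) = 1%N.

Definition up_walk (R : realType) (G : double_cover) (u u' : G) : R :=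
  if qleaf (qn u) then
    if (u' == u) || (u' == dc_opp u) then 2^-1 else 0
  else
    \sum_(v : G | [&& dc_edge u v, dc_edge u' v,
                      dc_sign v u == 1 & dc_sign v u' == -1])
      ((LP (qn v))%:R * (RP (qn u'))%:R) / ((LP (qn u))%:R * (RP (qn v))%:R).

Definition down_walk (R : realType) (G : double_cover) (u u' : G) : R :=
  if qroot (qn u) then
    if (u' == u) || (u' == dc_opp u) then 2^-1 else 0
  else
    \sum_(t : G | [&& dc_edge t u, dc_edge t u',
                      dc_sign u t == -1 & dc_sign u' t == 1])
      ((RP (qn t))%:R * (LP (qn u'))%:R) / ((RP (qn u))%:R * (LP (qn t))%:R).

Local Open Scope classical_set_scope.
Local Open Scope ring_scope.

Definition stochastic (R : realType) (n : nat) (P : 'M[R]_n) :=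
  forall i, (forall j, 0 <= P i j) /\ \sum_j P i j = 1.

Definition irreducible (R : realType) (n : nat) (P : 'M[R]_n) :=
  forall i j, exists t : nat, 0 < (P ^+ t) i j.

(* For every state, the gcd of its possible return times is 1. *)
Definition aperiodic (R : realType) (n : nat) (P : 'M[R]_n) :=
  forall i (d : nat),
    (forall t : nat, (0 < t)%N -> 0 < (P ^+ t) i i -> (d %| t)%N) -> d = 1%N.

Definition distribution_vec (R : realType) (n : nat) (mu : 'rV[R]_n) :=
  (forall i, 0 <= mu 0 i) /\ \sum_i mu 0 i = 1.

Definition stationary (R : realType) (n : nat) (P : 'M[R]_n) (mu : 'rV[R]_n) :=
  distribution_vec mu /\ mu *m P = mu.

Definition tv_dist (R : realType) (n : nat) (mu nu : 'rV[R]_n) : R :=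
  2^-1 * \sum_i `|mu 0 i - nu 0 i|.

(* A set of distributions on n states is null for the (n-1)-dimensional Lebesgue
   measure on the simplex: with any one coordinate i0 dropped (which gives an
   affine chart), it is covered by countably many boxes of R^(n-1) of
   arbitrarily small total volume. *)
Definition simplex_null (R : realType) (n : nat) (N : 'rV[R]_n -> Prop) :=
  forall (i0 : 'I_n) (e : R), 0 < e ->
  exists a b : nat -> 'rV[R]_n,
  [/\ forall m i, a m 0 i <= b m 0 i,
      forall mu, N mu ->
        exists m, forall i, i != i0 -> a m 0 i <= mu 0 i <= b m 0 i
    & (\sum_(0 <= m <oo) (\prod_(i < n | i != i0) (b m 0 i - a m 0 i))%:E
         <= e%:E)%E].

Definition almost_every_distribution (R : realType) (n : nat)
    (Q : 'rV[R]_n -> Prop) :=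
  simplex_null (fun mu => distribution_vec mu /\ ~ Q mu).

(* TV distance ~ c lambda^t with a constant c > 0 depending on the initial
   distribution [mu]; [pi] is the unique stationary distribution. *)
Definition convergence_rate (R : realType) (n : nat) (P : 'M[R]_n)
    (lambda : R) :=
  0 < lambda < 1 /\
  exists pi : 'rV[R]_n,
  [/\ stationary P pi,
      forall pi', stationary P pi' -> pi' = pi
    & almost_every_distribution (fun mu : 'rV[R]_n =>
        exists2 c : R, 0 < c &
          (fun t : nat => tv_dist (mu *m P ^+ t) pi / lambda ^+ t) @ \oo --> c)].

(* Main.v *)
(** The up-walk matrix is conjugate, by the square root of the stationary weight
    LP * RP, to a symmetric matrix commuting with the sign change u -> -u.  On
    functions even in u it acts as A^up, which is B B^T for the weighted incidence
    matrix B between C and the nodes D above it; on functions odd in u it acts as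
    A^{O,up} = - S S^T, S being B with the signs of the signature.  The down-walk
    is obtained in the same way from B^T B and - S^T S, which have the same nonzero
    eigenvalues.  Since LP and RP satisfy the path recursions, B and S are
    contractions, by a weighted variance identity whose equality case says that an
    eigenvector is constant, up to sign, along the nodes below a common node.
    Connectedness then makes 1 a simple eigenvalue of B B^T, and incoherence
    excludes the eigenvalue 1 of S S^T.  All remaining assertions about the walks
    follow from the spectral theorem; the initial distributions with a faster
    decay lie in a hyperplane of the simplex. *)

Require Import Defs.
From HB Require Import structures.
From mathcomp Require Import all_boot all_order all_algebra.
From mathcomp Require Import all_classical all_reals all_analysis.
From mathcomp.real_closed Require polyrcf complex.
From mathcomp Require Import ring lra.

Set Implicit Arguments.
Unset Strict Implicit.
Unset Printing Implicit Defensive.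

Import Order.TTheory GRing.Theory Num.Theory.
Import numFieldNormedType.Exports.

Local Open Scope ring_scope.

(** * Real symmetric matrices *)

Section SymmetricMatrices.
Variable R : realType.

(** Eigenvalues are read here by position in a sorted list of real roots, with default value 0. The
    real spectral theorem gives these positions a meaning: for a symmetric matrix the list is
    complete, and algebraic and geometric multiplicities agree. The two products in each Gram pair
    differ only in size and in the multiplicity of 0, so positions are compared inside the strictly
    positive or strictly negative part, where the default 0 stands for the missing zeros.
    Semidefiniteness also controls the rates: if the spectrum lies in [0,r], then A^t / r^t
    converges, and the minus sign of the odd part turns into one global factor (-1)^t.
    Irreducibility and aperiodicity need no study of paths; they are read off from the convergence
    of P^t to a positive stationary vector. Incoherence has a second use: it forces C and D to have
    at least two elements each, so that a second largest eigenvalue exists. *)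

Definition sqnorm n (v : 'rV[R]_n) : R := \sum_i v 0 i ^+ 2.

Lemma sqnormE n (v : 'rV[R]_n) : v *m v^T = (sqnorm v)%:M.
Proof.
apply/matrixP => i j; rewrite !ord1 !mxE eqxx mulr1n.
by apply: eq_bigr => l _; rewrite mxE expr2.
Qed.

Lemma sqnorm_ge0 n (v : 'rV[R]_n) : 0 <= sqnorm v.
Proof. by apply: sumr_ge0 => i _; rewrite sqr_ge0. Qed.

Lemma sqnorm_eq0 n (v : 'rV[R]_n) : (sqnorm v == 0) = (v == 0).
Proof.
apply/idP/eqP => [|->]; last by rewrite /sqnorm big1 // => i _; rewrite mxE expr0n.
rewrite psumr_eq0 => [/allP h|i _]; last exact: sqr_ge0.
apply/rowP => i; rewrite mxE; apply/eqP; rewrite -sqrf_eq0.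
exact: h (mem_index_enum i).
Qed.

Lemma sqnorm_gt0 n (v : 'rV[R]_n) : (0 < sqnorm v) = (v != 0).
Proof. by rewrite lt0r sqnorm_eq0 sqnorm_ge0 andbT. Qed.

Lemma sqnorm_mul m n (v : 'rV[R]_m) (B : 'M[R]_(m, n)) :
  v *m (B *m B^T) *m v^T = (sqnorm (v *m B))%:M.
Proof. by rewrite -sqnormE trmx_mul !mulmxA. Qed.

Lemma eigen_gram m n (B : 'M[R]_(m, n)) (v : 'rV[R]_m) x :
  v *m (B *m B^T) = x *: v -> sqnorm (v *m B) = x * sqnorm v.
Proof.
move=> h; have := sqnorm_mul v B; rewrite h -scalemxAl sqnormE scale_scalar_mx.
by move=> /matrixP/(_ 0 0); rewrite !mxE eqxx !mulr1n.
Qed.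

Lemma eigen_gram_ge0 m n (B : 'M[R]_(m, n)) x :
  eigenvalue (B *m B^T) x -> 0 <= x.
Proof.
case/eigenvalueP => v h nz; have := eigen_gram h.
move=> e; have := sqnorm_ge0 (v *m B); rewrite e pmulr_lge0 // sqnorm_gt0 //.
Qed.

Lemma sym_eigen_orth n (A : 'M[R]_n) (v w : 'rV[R]_n) x y : A^T = A ->
  v *m A = x *: v -> w *m A = y *: w -> x != y -> v *m w^T = 0.
Proof.
move=> symA hv hw xy.
have : x *: (v *m w^T) = y *: (v *m w^T).
  by rewrite scalemxAl -hv -mulmxA -{1}symA -trmx_mul hw linearZ -scalemxAr.
move/eqP; rewrite -subr_eq0 -scalerBl scaler_eq0 subr_eq0 (negPf xy) /=.
by move/eqP.
Qed.

Import complex.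

(** Some complex eigenvalue z exists. Symmetry forces Im z = 0, and then the real and imaginary
    parts of its eigenvector, not both zero, are each multiplied by Re z. *)
Lemma sym_eigenvalue n (A : 'M[R]_n.+1) : A^T = A -> exists x, eigenvalue A x.
Proof.
move=> symA; pose f := real_complex R; pose Ac := map_mx f A.
have [z /eigenvalueP[v hv nz]] := @eigenvalue_closed (complex R) n.+1 Ac isT.
pose a := map_mx (@Re R) v; pose b := map_mx (@Im R) v.
have Resum (F : 'I_n.+1 -> complex R) : Re (\sum_i F i) = \sum_i Re (F i).
  exact: (raddf_sum (@Re R)).
have Imsum (F : 'I_n.+1 -> complex R) : Im (\sum_i F i) = \sum_i Im (F i).
  exact: (raddf_sum (@Im R)).
have ha : a *m A = Re z *: a - Im z *: b.
  apply/rowP => j; have /(congr1 (fun m : 'rV_n.+1 => Re (m 0 j))) := hv.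
  rewrite !mxE Resum => e.
  transitivity (\sum_i Re (v 0 i * Ac i j)).
    apply: eq_bigr => i _; rewrite !mxE /=; case: (v 0 i) => p q /=; ring.
  by rewrite e; case: (z) (v 0 j) => [? ?] [? ?].
have hb : b *m A = Im z *: a + Re z *: b.
  apply/rowP => j; have /(congr1 (fun m : 'rV_n.+1 => Im (m 0 j))) := hv.
  rewrite !mxE Imsum => e.
  transitivity (\sum_i Im (v 0 i * Ac i j)).
    apply: eq_bigr => i _; rewrite !mxE /=; case: (v 0 i) => p q /=; ring.
  by rewrite e; case: (z) (v 0 j) => [? ?] [? ?] /=; rewrite addrC.
have nz' : 0 < sqnorm a + sqnorm b.
  rewrite lt0r addr_ge0 ?sqnorm_ge0 // andbT paddr_eq0 ?sqnorm_ge0 // !sqnorm_eq0.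
  apply: contra nz => /andP[/eqP/rowP a0 /eqP/rowP b0].
  apply/eqP/rowP => j; move: (a0 j) (b0 j); rewrite !mxE.
  by case: (v 0 j) => p q /= -> ->.
(* The 1x1 matrix [a A b^T] equals [b A a^T] by symmetry; expanding both sides leaves Im z times the
   positive number |a|^2 + |b|^2. *)
have z0 : Im z = 0.
  have e : a *m A *m b^T = (b *m A *m a^T)^T.
    by rewrite !trmx_mul trmxK symA mulmxA.
  move: e; rewrite ha hb !mulmxDl mulNmx -!scalemxAl [in RHS]linearD /=.
  rewrite [in RHS]linearZ [in RHS]linearZ /= !trmx_mul !trmxK !sqnormE.
  move/matrixP/(_ 0 0); rewrite !mxE eqxx !mulr1n => e.
  have /eqP : Im z * (sqnorm a + sqnorm b) = 0 by rewrite mulrDr; lra.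
  by rewrite mulf_eq0 (gt_eqF nz') orbF => /eqP.
exists (Re z); apply/eigenvalueP.
rewrite z0 scale0r subr0 in ha; rewrite z0 scale0r add0r in hb.
have [a0|] := eqVneq a 0; last by exists a.
exists b => //; move: nz'; rewrite a0 {1}/sqnorm big1 => [|i _].
  by rewrite add0r sqnorm_gt0.
by rewrite mxE expr0n.
Qed.

(* Householder reflection exchanging [u] and the first basis vector. *)
Lemma orthogonal_first_row n (u : 'rV[R]_n.+1) : sqnorm u = 1 ->
  exists2 Q : 'M[R]_n.+1, Q *m Q^T = 1%:M & row 0 Q = u.
Proof.
move=> u1; pose e0 : 'rV[R]_n.+1 := delta_mx 0 0.
have [->|ne] := eqVneq u e0.
  by exists 1%:M; rewrite ?trmx1 ?mulmx1 ?row1.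
have [w wE] : exists w, w = u - e0 by exists (u - e0).
pose c := 2 / sqnorm w.
have nw : sqnorm w != 0 by rewrite sqnorm_eq0 wE subr_eq0.
have ew : e0 *m w^T = (u 0 0 - 1)%:M.
  apply/matrixP => i j; rewrite !ord1 mxE (bigD1 0) //= big1 => [|l l0].
    by rewrite wE !mxE !eqxx mulr1n mul1r addr0.
  by rewrite !mxE eqxx (negPf l0) mul0r.
have nwE : sqnorm w = 2 * (1 - u 0 0).
  have -> : sqnorm w = sqnorm u + sqnorm e0 - 2 * \sum_i u 0 i * e0 0 i.
    rewrite /sqnorm mulr_sumr -big_split -sumrB /=; apply: eq_bigr => i _.
    by rewrite wE !mxE /=; ring.
  rewrite u1 /sqnorm (bigD1 0) //= big1 => [|l l0]; last first.
    by rewrite !mxE (negPf l0) andbF expr0n.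
  rewrite (bigD1 0) //= big1 => [|l l0]; last by rewrite !mxE (negPf l0) andbF mulr0.
  by rewrite !mxE !eqxx /=; ring.
pose Q := 1%:M - c *: (w^T *m w).
have QT : Q^T = Q by rewrite /Q linearB linearZ /= trmx1 trmx_mul trmxK.
exists Q.
  rewrite QT /Q mulmxBl mul1mx mulmxBr mulmx1 -scalemxAr -!scalemxAl.
  rewrite -mulmxA (mulmxA w) sqnormE mul_scalar_mx -scalemxAr !scalerA.
  have -> : c * c * sqnorm w = c + c by rewrite /c; field.
  by rewrite scalerDl; apply/matrixP => i j; rewrite !mxE; ring.
rewrite rowE -/e0 /Q mulmxBr mulmx1 -scalemxAr mulmxA ew mul_scalar_mx scalerA.
have -> : c * (u 0 0 - 1) = -1.
  rewrite /c nwE; field; move: nw; rewrite nwE mulf_eq0 => /norP[] //.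
by rewrite scaleN1r opprK wE addrC subrK.
Qed.

(** Deflation: in an orthonormal basis that starts with a unit eigenvector, the first row of the
    matrix is x e0. By symmetry so is the first column, and induction applies to the remaining
    block. The rows of [Q] are the eigenvectors. *)
Lemma sym_spectral n (A : 'M[R]_n) : A^T = A ->
  exists Q : 'M[R]_n, exists d : 'rV[R]_n,
    Q *m Q^T = 1%:M /\ A = Q^T *m diag_mx d *m Q.
Proof.
elim: n A => [|n IH] A symA.
  by exists 1%:M, 0; split; apply/matrixP => -[].
have [x /eigenvalueP[v hv nz]] := sym_eigenvalue symA.
pose u := (Num.sqrt (sqnorm v))^-1 *: v.
have u1 : sqnorm u = 1.
  have -> : sqnorm u = (Num.sqrt (sqnorm v))^-1 ^+ 2 * sqnorm v.
    by rewrite mulr_sumr; apply: eq_bigr => i _; rewrite mxE exprMn.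
  by rewrite exprVn sqr_sqrtr ?sqnorm_ge0 // mulVf // sqnorm_eq0.
have hu : u *m A = x *: u by rewrite -scalemxAl hv !scalerA mulrC.
have [Q QQ rQ] := orthogonal_first_row u1.
have QQ' : Q^T *m Q = 1%:M by apply: mulmx1C.
pose M : 'M[R]_(1 + n) := Q *m A *m Q^T.
have symM : M^T = M by rewrite /M !trmx_mul trmxK symA mulmxA.
have rM : row 0 M = x *: delta_mx 0 0.
  by rewrite /M !row_mul rQ hu -scalemxAl -rQ -row_mul QQ row1.
have M0 j : M 0 j = x *+ (j == 0).
  have := congr1 (fun r : 'rV_n.+1 => r 0 j) rM; rewrite !mxE eqxx /= => ->.
  by case: eqP => _; rewrite /= ?mulr0 ?mulr1.
have l0 : lshift n 0 = 0 :> 'I_(1 + n) by apply: val_inj.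
have ulM : ulsubmx M = x%:M.
  by apply/matrixP => i j; rewrite !ord1 [LHS]mxE [LHS]mxE l0 M0 !mxE !eqxx.
have urM : ursubmx M = 0.
  by apply/matrixP => i j; rewrite !ord1 [LHS]mxE [LHS]mxE l0 M0 !mxE.
have dlM : dlsubmx M = 0 by rewrite -[M]symM -trmx_ursub urM trmx0.
have ME : M = block_mx x%:M 0 0 (drsubmx M).
  by rewrite -{1}[M]submxK ulM urM dlM.
have [Q1 [d1 [QQ1 eM]]] := IH (drsubmx M) (etrans (trmx_drsub _) (congr1 _ symM)).
pose T : 'M[R]_(1 + n) := block_mx 1%:M 0 0 Q1.
have TT : T *m T^T = 1%:M.
  rewrite /T tr_block_mx mulmx_block !trmx0 trmx1.
  by rewrite !(mulmx0, mul0mx, addr0, add0r, mulmx1) QQ1 -scalar_mx_block.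
have MT : M = T^T *m diag_mx (row_mx (x%:M : 'rV_1) d1) *m T.
  have -> : diag_mx (row_mx (x%:M : 'rV_1) d1) = block_mx x%:M 0 0 (diag_mx d1).
    rewrite diag_mx_row; congr block_mx.
    by apply/matrixP => i j; rewrite !ord1 !mxE.
  rewrite ME eM /T tr_block_mx !mulmx_block !trmx0 trmx1.
  by rewrite !(mulmx0, mul0mx, addr0, add0r, mulmx1, mul1mx).
exists ((T : 'M[R]_n.+1) *m Q), (row_mx x%:M d1 : 'rV[R]_n.+1); split.
  by rewrite trmx_mul mulmxA -(mulmxA (T : 'M[R]_n.+1)) QQ mulmx1.
have -> : A = Q^T *m (M : 'M[R]_n.+1) *m Q.
  by rewrite /M !mulmxA QQ' mul1mx -mulmxA QQ' mulmx1.
by rewrite MT trmx_mul !mulmxA.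
Qed.

End SymmetricMatrices.

(** * Eigenvalues with multiplicity *)

(** Sylvester's identity: multiplying the block matrix [N] by a unipotent triangular matrix on the
    right, or by a triangular one on the left, computes its determinant in two ways. *)
Lemma char_poly_mulC (F : fieldType) m n (B : 'M[F]_(m, n)) (C : 'M[F]_(n, m)) :
  'X^n * char_poly (B *m C) = 'X^m * char_poly (C *m B).
Proof.
pose b := map_mx (@polyC F) B; pose c := map_mx (@polyC F) C.
pose N : 'M[{poly F}]_(m + n) := block_mx 'X%:M b c 1%:M.
have e1 : N *m block_mx 1%:M 0 (- c) 1%:M = block_mx ('X%:M - b *m c) b 0 1%:M.
  rewrite mulmx_block !(mulmx0, mul0mx, addr0, add0r, mulmx1, mul1mx) mulmxN.
  by rewrite subrr.
have e2 : block_mx 1%:M 0 (- c) 'X%:M *m N = block_mx 'X%:M b 0 ('X%:M - c *m b).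
  rewrite mulmx_block !(mulmx0, mul0mx, addr0, add0r, mulmx1, mul1mx) !mulNmx.
  by rewrite scalar_mxC addNr addrC.
have d1 : \det N = char_poly (B *m C).
  have := congr1 determinant e1; rewrite det_mulmx det_lblock det_ublock.
  rewrite !det1 !mulr1 => ->.
  by rewrite /char_poly /char_poly_mx map_mxM.
have d2 : 'X^n * \det N = 'X^m * char_poly (C *m B).
  have := congr1 determinant e2; rewrite det_mulmx det_lblock det_ublock.
  rewrite !det1 !mul1r !det_scalar => ->.
  by rewrite /char_poly /char_poly_mx map_mxM.
by rewrite -d1.
Qed.

Lemma mup_char_poly_mulC (F : fieldType) m n (B : 'M[F]_(m, n))
    (C : 'M[F]_(n, m)) x :
  x != 0 -> mup x (char_poly (B *m C)) = mup x (char_poly (C *m B)).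
Proof.
move=> x0; have nr (l : nat) : ~~ root ('X^l : {poly F}) x.
  by rewrite rootE hornerXn expf_neq0.
by rewrite -(mupMr _ (nr n)) char_poly_mulC mupMr.
Qed.

Section Eigvals.
Variable R : realType.

Lemma char_poly_neq0 n (A : 'M[R]_n) : char_poly A != 0.
Proof. exact/monic_neq0/char_poly_monic. Qed.

Lemma mem_rootsR (p : {poly R}) x : p != 0 ->
  (x \in polyrcf.rootsR p) = root p x.
Proof. by move=> p0; rewrite -(polyrcf.roots_on_rootsR p0) in_itv. Qed.

Lemma count_eigvals n (A : 'M[R]_n) x :
  count_mem x (eigvals A) = mup x (char_poly A).
Proof.
rewrite /eigvals count_flatten -map_comp.
have cE y : (count_mem x \o (fun y => nseq (mup y (char_poly A)) y)) y
           = if y == x then mup x (char_poly A) else 0%N.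
  by rewrite /= count_nseq /=; case: eqP => [->|_]; rewrite ?mul1n ?mul0n.
rewrite (eq_map cE); have := polyrcf.uniq_roots (- polyrcf.cauchy_bound (char_poly A))
  (polyrcf.cauchy_bound (char_poly A)) (char_poly A).
rewrite -/(polyrcf.rootsR _) => un.
have /esym := mem_rootsR x (char_poly_neq0 A).
elim: (polyrcf.rootsR _) un => [|y s IH] /=; first by move=> _ /negbT/mupNroot.
move=> /andP[ys us]; rewrite inE eq_sym; case: eqP => [yx _|_ /IH-> //].
rewrite -[RHS]addn0; congr (_ + _)%N; subst y.
elim: (s) ys => //= z t IHt; rewrite inE negb_or eq_sym => /andP[/negPf-> /IHt].
by move=> ->.
Qed.

Lemma mem_eigvals n (A : 'M[R]_n) x : (x \in eigvals A) = eigenvalue A x.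
Proof.
rewrite -has_pred1 has_count count_eigvals eigenvalue_root_char.
by rewrite mup_geq ?char_poly_neq0 // expr1 dvdp_XsubCl.
Qed.

Lemma sorted_eigvals n (A : 'M[R]_n) : sorted <=%R (eigvals A).
Proof.
rewrite /eigvals /polyrcf.rootsR.
have := polyrcf.sorted_roots (- polyrcf.cauchy_bound (char_poly A))
  (polyrcf.cauchy_bound (char_poly A)) (char_poly A).
elim: (polyrcf.roots _ _ _) => //= y s IH ss.
rewrite (sorted_pairwise le_trans) pairwise_cat.
have -> /= : pairwise <=%R (flatten [seq nseq (mup x (char_poly A)) x | x <- s]).
  by rewrite -(sorted_pairwise le_trans) IH // (path_sorted ss).
rewrite andbT; apply/andP; split.
  apply/allrelP => a b /nseqP[-> _] /flatten_mapP[z zs /nseqP[-> _]].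
  by have /allP/(_ _ zs)/ltW := order_path_min lt_trans ss.
rewrite -(sorted_pairwise le_trans); case: (mup _ _) => //= l.
by elim: l => //= l ->; rewrite lexx.
Qed.

Lemma perm_eigvals_diag n (A Q : 'M[R]_n) (d : 'rV[R]_n) :
  Q *m Q^T = 1%:M -> A = Q^T *m diag_mx d *m Q ->
  perm_eq (eigvals A) [seq d 0 i | i : 'I_n].
Proof.
move=> QQ AE; have QQ' : Q^T *m Q = 1%:M by apply: mulmx1C.
have cA : char_poly A = \prod_(x <- [seq d 0 i | i : 'I_n]) ('X - x%:P).
  transitivity (char_poly (diag_mx d)).
    rewrite /char_poly.
    have -> : char_poly_mx A = map_mx (@polyC R) Q^T *m char_poly_mx (diag_mx d)
              *m map_mx (@polyC R) Q.
      rewrite /char_poly_mx mulmxBr mulmxBl -!map_mxM -AE; congr (_ - _).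
      by rewrite scalar_mxC -mulmxA -map_mxM QQ' map_mx1 mulmx1.
    rewrite !det_mulmx mulrC mulrA -det_mulmx -map_mxM QQ map_mx1 det1 mul1r //.
  rewrite char_poly_trig ?diag_mx_is_trig // big_image /=.
  by apply: eq_bigr => i _; rewrite mxE eqxx.
apply/allP => x _ /=; apply/eqP.
by rewrite count_eigvals cA mu_prod_XsubC.
Qed.

(** [eigvals] collects real roots only, so its length is n only because the matrix is orthogonally
    diagonalizable; counting from the end of the list relies on this. *)
Lemma size_eigvals_sym n (A : 'M[R]_n) : A^T = A -> size (eigvals A) = n.
Proof.
move=> /sym_spectral[Q [d [QQ AE]]].
by rewrite (perm_size (perm_eigvals_diag QQ AE)) size_map -cardE card_ord.
Qed.

(** A sorted list is determined by its multiplicities. The restriction to [P] serves to leave out 0,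
    where the two products of a Gram pair may differ. *)
Lemma eigvals_eq_on m n (A : 'M[R]_m) (B : 'M[R]_n) (P : pred R) :
  (forall x, P x -> mup x (char_poly A) = mup x (char_poly B)) ->
  seq.filter P (eigvals A) = seq.filter P (eigvals B).
Proof.
move=> h; apply: (@sorted_eq _ <=%R); [exact: le_trans|exact: le_anti| | |].
- by apply: sorted_filter; [apply: le_trans|apply: sorted_eigvals].
- by apply: sorted_filter; [apply: le_trans|apply: sorted_eigvals].
apply/allP => x _ /=; rewrite !count_filter.
have [Px|nPx] := boolP (P x).
  have e s : count (predI (pred1 x) P) s = count_mem x s.
    by apply: eq_count => y /=; case: eqP => [->|//]; rewrite Px.
  by rewrite !e !count_eigvals h.
have e s : count (predI (pred1 x) P) s = 0%N.
  apply/eqP; rewrite -leqn0 leqNgt -has_count -all_predC; apply/allP => y _ /=.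
  by case: eqP => [->|//]; rewrite (negPf nPx).
by rewrite !e.
Qed.

Lemma sorted_le_filter (s : seq R) y : sorted <=%R s ->
  s = seq.filter (fun x => x <= y) s ++ seq.filter (fun x => ~~ (x <= y)) s.
Proof.
elim: s => //= x s IH ps; have {}IH := IH (path_sorted ps).
have [xy|yx] := boolP (x <= y); first by rewrite /= -IH.
have mn := order_path_min le_trans ps.
have f0 : [seq z <- s | z <= y] = [::].
  apply/eqP; rewrite -[_ == _]negbK -has_filter -all_predC.
  apply/allP => z zs /=; rewrite -ltNge; apply: lt_le_trans (allP mn _ zs).
  by rewrite ltNge.
by rewrite f0 /= {1}IH f0.
Qed.

(** The eigenvalues are nonnegative, so the second one from the top is either the second positive
    one or 0, and 0 is also the default value of the filtered list. Having at least two rows keeps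
    the position within the full list. The filtered lists of the two products coincide. *)
Lemma lambda_max1_gram m n (B : 'M[R]_(m, n)) : (1 < m)%N -> (1 < n)%N ->
  lambda_max1 (B *m B^T) = lambda_max1 (B^T *m B).
Proof.
suff h p q (M : 'M[R]_(p, q)) : (1 < p)%N ->
    lambda_max1 (M *m M^T)
    = nth 0 (rev [seq x <- eigvals (M *m M^T) | ~~ (x <= 0)]) 1.
  move=> m1 n1; rewrite h //.
  have := h _ _ B^T n1; rewrite trmxK => ->.
  by rewrite (@eigvals_eq_on _ _ _ (B^T *m B)) // => x x0;
     apply: mup_char_poly_mulC; apply: contra x0 => /eqP->.
move=> p1; rewrite /lambda_max1.
have : size (eigvals (M *m M^T)) = p.
  by apply: size_eigvals_sym; rewrite trmx_mul trmxK.
have e := sorted_le_filter 0 (sorted_eigvals (M *m M^T)).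
have z : [seq x <- eigvals (M *m M^T) | x <= 0]
         = nseq (size [seq x <- eigvals (M *m M^T) | x <= 0]) 0.
  apply/all_pred1P/allP => x; rewrite mem_filter mem_eigvals => /andP[x0 ev] /=.
  by apply/eqP/le_anti; rewrite x0 (eigen_gram_ge0 ev).
move: e; rewrite z; set k := size _; set u := [seq _ <- _ | _] => e sz.
have -> : (size (eigvals (M *m M^T))).-2 = (size (eigvals (M *m M^T)) - 2)%N.
  by rewrite subn2.
rewrite -nth_rev ?sz // e rev_cat nth_cat; case: ltnP => // us.
have -> : rev (nseq k (0 : R)) = nseq k 0.
  by apply: (@eq_from_nth _ 0) => [|i]; rewrite size_rev // => ik;
     rewrite nth_rev // !nth_nseq; case: ifP; case: ifP.
by rewrite nth_nseq if_same nth_default.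
Qed.

(** All eigenvalues are at most 0, so the smallest one is the first negative one if there is any,
    and otherwise 0, the default value. *)
Lemma lambda_min_gram m n (B : 'M[R]_(m, n)) :
  lambda_min (- (B *m B^T)) = lambda_min (- (B^T *m B)).
Proof.
suff h p q (M : 'M[R]_(p, q)) :
    lambda_min (- (M *m M^T))
    = nth 0 [seq x <- eigvals (- (M *m M^T)) | x < 0] 0.
  rewrite h.
  have := h _ _ B^T; rewrite trmxK => ->.
  rewrite (@eigvals_eq_on _ _ _ (- (B^T *m B))) // => x x0.
  by rewrite -mulNmx mup_char_poly_mulC ?lt_eqF // mulmxN.
rewrite /lambda_min.
have : all (fun x => x <= 0) (eigvals (- (M *m M^T))).
  apply/allP => x; rewrite mem_eigvals => /eigenvalueP[v hv nz].
  rewrite -oppr_ge0; apply: (@eigen_gram_ge0 _ _ _ M); apply/eigenvalueP.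
  by exists v => //; rewrite scaleNr -hv mulmxN opprK.
have := sorted_eigvals (- (M *m M^T)).
case: (eigvals _) => //= x s ps /andP[]; rewrite le_eqVlt.
case: ltrP => //= x0; rewrite orbF => /eqP xe /allP sa.
rewrite (@eq_in_filter _ _ pred0) ?filter_pred0 // => y ys.
apply/negbTE; rewrite -leNgt -xe.
exact: (allP (order_path_min le_trans ps)).
Qed.

End Eigvals.

(** * Weighted contractions and powers *)

Section Contraction.
Variable R : realType.

(** Lagrange's identity: the variance of [g] under the weights [p], with the total mass left
    unnormalized. *)
Lemma weighted_variance (I : finType) (p g : I -> R) :
  (\sum_i p i) * (\sum_i p i * g i ^+ 2) - (\sum_i p i * g i) ^+ 2
  = 2^-1 * \sum_i \sum_k p i * p k * (g i - g k) ^+ 2.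
Proof.
have e i k : p i * p k * (g i - g k) ^+ 2
    = (p i * g i ^+ 2) * p k + p i * (p k * g k ^+ 2) - 2 * ((p i * g i) * (p k * g k)).
  by ring.
under [in RHS]eq_bigr => i _ do under eq_bigr => k _ do rewrite e.
under [in RHS]eq_bigr => i _ do
  rewrite sumrB big_split /= -!mulr_sumr.
rewrite sumrB big_split /= -mulr_sumr -!mulr_suml.
by rewrite expr2; field.
Qed.

Variables (m n : nat) (S : 'M[R]_(m, n)) (x : 'I_m -> R) (y : 'I_n -> R).
Hypothesis x_gt0 : forall i, 0 < x i.
Hypothesis xS : forall j, \sum_i x i * `|S i j| = y j.
Hypothesis Sy : forall i, \sum_j `|S i j| * y j = x i.

Let p i j := x i * `|S i j|.
Let g (f : 'rV[R]_m) j i := Num.sg (S i j) * (f 0 i / x i).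

(** In each column j this is the weighted variance of the signed ratios f_i / x_i with weights x_i
    |S_ij|. Their total mass is y_j and their first moment is the j-th entry of f S; by [Sy] the
    second moments add up to |f|^2. *)
Lemma sqnorm_defect (f : 'rV[R]_m) :
  sqnorm f - sqnorm (f *m S)
  = 2^-1 * \sum_j \sum_i \sum_k p i j * p k j * (g f j i - g f j k) ^+ 2.
Proof.
rewrite mulr_sumr; under eq_bigr => j _ do rewrite -weighted_variance xS.
rewrite sumrB; congr (_ - _); last first.
  apply: eq_bigr => j _; congr (_ ^+ 2); rewrite mxE; apply: eq_bigr => i _.
  rewrite {1}(numEsg (S i j)) /p /g; field.
  by rewrite gt_eqF.
under eq_bigr => j _ do rewrite mulr_sumr.
rewrite exchange_big /=; apply: eq_bigr => i _.
transitivity (\sum_j `|S i j| * y j * (f 0 i ^+ 2 / x i)).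
  by rewrite -mulr_suml Sy mulrCA divff ?mulr1 // gt_eqF.
apply: eq_bigr => j _; rewrite /p /g.
have [->|nz] := eqVneq (S i j) 0; first by rewrite normr0 mulr0 !mul0r mulr0.
have s1 : Num.sg (S i j) ^+ 2 = 1 by rewrite sqr_sg nz.
rewrite exprMn s1; field.
by rewrite gt_eqF.
Qed.

Lemma p_ge0 i j : 0 <= p i j.
Proof. by rewrite mulr_ge0 // ltW. Qed.

Lemma contraction_gram (f : 'rV[R]_m) : sqnorm (f *m S) <= sqnorm f.
Proof.
rewrite -subr_ge0 sqnorm_defect mulr_ge0 ?invr_ge0 ?ler0n //.
apply: sumr_ge0 => j _; apply: sumr_ge0 => i _; apply: sumr_ge0 => k _.
by rewrite mulr_ge0 ?sqr_ge0 // mulr_ge0 // p_ge0.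
Qed.

Lemma eigen_gram_le1 l : eigenvalue (S *m S^T) l -> l <= 1.
Proof.
case/eigenvalueP => v h nz; have := contraction_gram v.
by rewrite (eigen_gram h) ger_pMl // sqnorm_gt0.
Qed.

(** A fixed vector of S S^T has defect 0, so every term of the variance vanishes, and the weights
    are positive wherever [S] does not vanish. *)
Lemma contraction_gram_eq (f : 'rV[R]_m) i k j :
  f *m (S *m S^T) = f -> S i j != 0 -> S k j != 0 ->
  Num.sg (S i j) * (f 0 i / x i) = Num.sg (S k j) * (f 0 k / x k).
Proof.
move=> hf Sij Skj; have /eigen_gram : f *m (S *m S^T) = 1 *: f by rewrite scale1r.
rewrite mul1r => /eqP; rewrite eq_sym -subr_eq0 sqnorm_defect.
have ge j' i' k' : 0 <= p i' j' * p k' j' * (g f j' i' - g f j' k') ^+ 2.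
  by rewrite mulr_ge0 ?sqr_ge0 // mulr_ge0 // p_ge0.
have zero (I : finType) (F : I -> R) : (forall i, 0 <= F i) ->
    \sum_i F i = 0 -> forall i, F i = 0.
  by move=> F0 /psumr_eq0P h i'; apply: h.
have ge1 j' i' : 0 <= \sum_k' p i' j' * p k' j' * (g f j' i' - g f j' k') ^+ 2.
  exact: sumr_ge0.
have ge2 j' :
    0 <= \sum_i' \sum_k' p i' j' * p k' j' * (g f j' i' - g f j' k') ^+ 2.
  exact: sumr_ge0.
rewrite mulf_eq0 invr_eq0 pnatr_eq0 /= => /eqP/(zero _ _ ge2)/(_ j).
move=> /(zero _ _ (ge1 j))/(_ i)/(zero _ _ (ge j i))/(_ k)/eqP.
have pn l : S l j != 0 -> p l j != 0.
  by move=> h; rewrite mulf_neq0 ?normr_eq0 // gt_eqF.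
rewrite mulf_eq0 (negPf (mulf_neq0 (pn _ Sij) (pn _ Skj))) /= sqrf_eq0 subr_eq0.
by move=> /eqP.
Qed.

End Contraction.

(** * Simple and extreme eigenvalues, and limits of matrix powers *)

Section SpectrumOfSymmetric.
Variable R : realType.

(** A repeated eigenvalue would give two distinct rows of the orthogonal matrix [Q] with eigenvalue
    x; both would be multiples of [w], which contradicts their orthonormality. *)
Lemma simple_mup n (A : 'M[R]_n) (w : 'rV[R]_n) x : A^T = A -> w != 0 ->
  w *m A = x *: w -> (forall f, f *m A = x *: f -> exists c, f = c *: w) ->
  mup x (char_poly A) = 1%N.
Proof.
move=> symA w0 hw un; have [Q [d [QQ AE]]] := sym_spectral symA.
have /permP/(_ (pred1 x)) := perm_eigvals_diag QQ AE.
rewrite count_eigvals => ->.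
have ev : has (pred1 x) [seq d 0 i | i : 'I_n].
  rewrite has_pred1 -(perm_mem (perm_eigvals_diag QQ AE)) mem_eigvals.
  by apply/eigenvalueP; exists w.
apply/eqP; rewrite eqn_leq -has_count ev andbT count_map -size_filter.
have rowA i : row i Q *m A = d 0 i *: row i Q.
  rewrite -row_mul AE !mulmxA QQ mul1mx rowE mulmxA -rowE row_diag_mx.
  by rewrite -scalemxAl -rowE.
have orth i k : (row i Q *m (row k Q)^T) 0 0 = (i == k)%:R.
  transitivity ((Q *m Q^T) i k); last by rewrite QQ mxE.
  by rewrite !mxE; apply: eq_bigr => l _; rewrite !mxE.
have: uniq [seq i <- enum 'I_n | preim (fun i => d 0 i) (pred1 x) i].
  by rewrite filter_uniq ?enum_uniq.
case E : [seq _ <- _ | _] => [|i [|k s]] //= /andP[]; rewrite inE negb_or.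
move=> /andP[ik _] _.
have [di dk] : d 0 i = x /\ d 0 k = x.
  have : i \in [seq i <- enum 'I_n | preim (fun i => d 0 i) (pred1 x) i].
    by rewrite E inE eqxx.
  have : k \in [seq i <- enum 'I_n | preim (fun i => d 0 i) (pred1 x) i].
    by rewrite E !inE eqxx orbT.
  by rewrite !mem_filter /= => /andP[/eqP-> _] /andP[/eqP-> _].
have [a ea] : exists c, row i Q = c *: w by apply: un; rewrite rowA di.
have [b eb] : exists c, row k Q = c *: w by apply: un; rewrite rowA dk.
have := orth i k; have := orth i i; have := orth k k.
have sc u v : ((u *: w) *m (v *: w)^T) 0 0 = u * v * sqnorm w.
  rewrite mxE mulr_sumr; apply: eq_bigr => l _; rewrite !mxE; ring.
rewrite ea eb !sc !eqxx (negPf ik) => bb aa /eqP; rewrite !mulf_eq0.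
move=> /orP[/orP[]/eqP h|/eqP h]; move: bb aa; rewrite h !(mulr0, mul0r) => bb aa.
- by have /eqP := aa; rewrite eq_sym oner_eq0.
- by have /eqP := bb; rewrite eq_sym oner_eq0.
- by have /eqP := bb; rewrite eq_sym oner_eq0.
Qed.

Lemma lambda_max1_lt n (A : 'M[R]_n) x : A^T = A -> (1 < n)%N ->
  (forall y, eigenvalue A y -> y <= x) -> mup x (char_poly A) = 1%N ->
  [/\ lambda_max1 A < x, eigenvalue A (lambda_max1 A)
    & forall y, eigenvalue A y -> y != x -> y <= lambda_max1 A].
Proof.
move=> symA n1 mx; rewrite -count_eigvals => c1.
have xs : x \in eigvals A by rewrite -has_pred1 has_count c1.
have := sorted_eigvals A; have := size_eigvals_sym symA.
have {mx} mx y : y \in eigvals A -> y <= x by rewrite mem_eigvals; apply: mx.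
rewrite /lambda_max1 -mem_eigvals.
have me y : eigenvalue A y = (y \in eigvals A) by rewrite mem_eigvals.
case: (lastP (eigvals A)) c1 xs mx me => [|s b]; first by [].
case: (lastP s) => [|{}s a] c1 xs mx me sz.
  by exfalso; move: n1; rewrite -sz.
rewrite (sorted_pairwise le_trans) !pairwise_rcons !all_rcons.
move=> /and3P[/andP[ab /allP sb] /allP sa _].
have -> : (size (rcons (rcons s a) b)).-2 = size s by rewrite !size_rcons.
rewrite !nth_rcons size_rcons ltnSn ltnn eqxx.
have bx : b = x.
  apply/le_anti; rewrite mx ?mem_rcons ?inE ?eqxx //=.
  by move: xs; rewrite !(mem_rcons, inE) => /or3P[/eqP->|/eqP->|/sb].
have ax : a != x.
  apply/eqP => ax; move: c1; rewrite -!cats1 !count_cat /= bx ax eqxx.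
  by rewrite -addnA addnC.
split.
- by rewrite lt_neqAle ax mx // !(mem_rcons, inE) eqxx orbT.
- by rewrite !(mem_rcons, inE) eqxx orbT.
move=> y; rewrite me !(mem_rcons, inE) bx => /or3P[/eqP->|/eqP->|/sa //].
- by rewrite eqxx.
- by rewrite lexx.
Qed.

Lemma lambda_minP n (A : 'M[R]_n) : A^T = A -> (0 < n)%N ->
  eigenvalue A (lambda_min A) /\ forall y, eigenvalue A y -> lambda_min A <= y.
Proof.
move=> symA n0; rewrite /lambda_min -mem_eigvals.
have me y : eigenvalue A y = (y \in eigvals A) by rewrite mem_eigvals.
have := sorted_eigvals A; have := size_eigvals_sym symA.
case: (eigvals A) me => [|a s] me sz /= ps; first by exfalso; move: n0; rewrite -sz.
rewrite inE eqxx; split=> // y; rewrite me inE => /orP[/eqP->//|ys].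
exact: (allP (order_path_min le_trans ps)).
Qed.

Lemma diag_mxX n (d : 'rV[R]_n) t : (diag_mx d) ^+ t = diag_mx (map_mx (fun x => x ^+ t) d).
Proof.
elim: t => [|t IH].
  by rewrite expr0 -[1]/(1%:M); apply/matrixP => i j; rewrite !mxE expr0.
by rewrite exprS IH -[_ * _]/(_ *m _) mulmx_diag; congr diag_mx; apply/rowP => i; rewrite !mxE exprS.
Qed.

Lemma conjmxX n (Q D : 'M[R]_n) t : Q *m Q^T = 1%:M ->
  (Q^T *m D *m Q) ^+ t = Q^T *m D ^+ t *m Q.
Proof.
move=> QQ; elim: t => [|t IH]; first by rewrite !expr0 mulmx1 (mulmx1C QQ).
rewrite !exprS IH -[_ * _]/(_ *m _) -[D * _]/(D *m _) !mulmxA.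
by rewrite -(mulmxA _ Q) QQ mulmx1.
Qed.

Lemma cvg_sumr (I : Type) (r : seq I) (F : I -> nat -> R) (l : I -> R) :
  (forall i, (F i @ \oo --> l i)%classic) ->
  ((fun t => \sum_(i <- r) F i t) @ \oo --> \sum_(i <- r) l i)%classic.
Proof.
move=> h; elim: r => [|i r IH].
  by rewrite big_nil; under eq_fun do rewrite big_nil; exact: cvg_cst.
by rewrite big_cons; under eq_fun do rewrite big_cons; apply: cvgD.
Qed.

Lemma cvg_expr01 (r : R) : 0 <= r <= 1 ->
  ((fun t : nat => r ^+ t) @ \oo --> ((r == 1)%:R : R))%classic.
Proof.
move=> /andP[r0 r1]; have [->|rn] := eqVneq r 1.
  rewrite (_ : (fun t : nat => 1 ^+ t) = (fun=> 1)); first exact: cvg_cst.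
  by apply/funext => t; rewrite expr1n.
by apply: cvg_expr; rewrite ger0_norm // lt_neqAle rn.
Qed.

(** [E] is the orthogonal projection onto the eigenspace of l, possibly zero. In an eigenbasis each
    coordinate contributes (d_k / l)^t with ratio in [0,1], which tends to 1 if d_k = l and to 0
    otherwise; nonnegativity rules out oscillation. *)
Lemma psd_pow_cvg n (A : 'M[R]_n) l : A^T = A -> 0 < l ->
  (forall y, eigenvalue A y -> 0 <= y <= l) ->
  exists E : 'M[R]_n,
  (forall i j, ((fun t => (A ^+ t) i j / l ^+ t) @ \oo --> E i j)%classic) /\
  (forall f : 'rV[R]_n, f *m A = l *: f -> E *m f^T = f^T).
Proof.
move=> symA l0 ev; have [Q [d [QQ AE]]] := sym_spectral symA.
have QQ' : Q^T *m Q = 1%:M by apply: mulmx1C.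
pose e : 'rV[R]_n := \row_i (d 0 i == l)%:R.
exists (Q^T *m diag_mx e *m Q); split.
  move=> i j.
  have -> : (fun t => (A ^+ t) i j / l ^+ t)
     = (fun t => \sum_k Q k i * Q k j * (d 0 k / l) ^+ t).
    apply/funext => t; rewrite AE conjmxX // diag_mxX mul_mx_diag mxE mulr_suml.
    by apply: eq_bigr => k _; rewrite !mxE expr_div_n; ring.
  have -> : (Q^T *m diag_mx e *m Q) i j = \sum_k Q k i * Q k j * e 0 k.
    by rewrite mul_mx_diag mxE; apply: eq_bigr => k _; rewrite !mxE; ring.
  apply: cvg_sumr => k; apply: cvgM; first exact: cvg_cst.
  have /ev/andP[d0 dl] : eigenvalue A (d 0 k).
    rewrite -mem_eigvals (perm_mem (perm_eigvals_diag QQ AE)).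
    by apply/mapP; exists k; rewrite ?mem_enum.
  have -> : e 0 k = (d 0 k / l == 1)%:R.
    rewrite mxE; suff -> : (d 0 k / l == 1) = (d 0 k == l) by [].
    apply/eqP/eqP => [h|->]; last by rewrite divff ?gt_eqF.
    by rewrite -[l]mul1r -h divfK ?gt_eqF.
  by apply: cvg_expr01; rewrite divr_ge0 ?(ltW l0) // ler_pdivrMr ?mul1r.
move=> f hf; have [g gE] : exists g, g = Q *m f^T by exists (Q *m f^T).
have hg : diag_mx d *m g = l *: g.
  have : A *m f^T = l *: f^T by rewrite -{1}symA -trmx_mul hf linearZ.
  by move/(congr1 (mulmx Q)); rewrite AE !mulmxA QQ mul1mx -!mulmxA -scalemxAr -gE.
have {}hg i j : d 0 i * g i j = l * g i j.
  by have /matrixP/(_ i j) := hg; rewrite mul_diag_mx [LHS]mxE [RHS]mxE.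
rewrite -!mulmxA -gE; have -> : diag_mx e *m g = g.
  apply/matrixP => i j; rewrite mul_diag_mx [LHS]mxE [e 0 i]mxE.
  case: eqP => [_|/eqP dl]; first by rewrite mul1r.
  have /eqP : (d 0 i - l) * g i j = 0 by rewrite mulrBl hg subrr.
  by rewrite mulf_eq0 subr_eq0 (negPf dl) mul0r => /eqP->.
by rewrite gE mulmxA QQ' mul1mx.
Qed.

End SpectrumOfSymmetric.

(** * Hyperplane sections of the simplex *)

Section NullHyperplane.
Variable R : realType.

(** The finite family is padded to a sequence by degenerate boxes at the origin. Their volume is 0
    because the product contains the factor of index j; without such an index it would be the empty
    product 1. *)
Lemma finite_boxes_null n (N : 'rV[R]_n -> Prop) (i0 j : 'I_n) (e : R)
    (T : finType) (lo hi : T -> 'rV[R]_n) : j != i0 ->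
  (forall g i, lo g 0 i <= hi g 0 i) ->
  (forall mu, N mu -> exists g, forall i, i != i0 -> lo g 0 i <= mu 0 i <= hi g 0 i) ->
  \sum_g \prod_(i < n | i != i0) (hi g 0 i - lo g 0 i) <= e ->
  exists a b : nat -> 'rV[R]_n,
  [/\ forall m i, a m 0 i <= b m 0 i,
      forall mu, N mu ->
        exists m, forall i, i != i0 -> a m 0 i <= mu 0 i <= b m 0 i
    & (\sum_(0 <= m <oo) (\prod_(i < n | i != i0) (b m 0 i - a m 0 i))%:E
         <= e%:E)%E].
Proof.
move=> ji le cov vol.
pose box (F : T -> 'rV[R]_n) (m : nat) : 'rV[R]_n :=
  if insub m is Some x then F (enum_val (x : 'I_#|T|)) else 0.
have boxv F (x : 'I_#|T|) : box F x = F (enum_val x) by rewrite /box valK.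
have boxn F m : (#|T| <= m)%N -> box F m = 0.
  by move=> h; rewrite /box insubN // -leqNgt.
have lebox m i : box lo m 0 i <= box hi m 0 i.
  have [h|h] := ltnP m #|T|; last by rewrite !boxn.
  by rewrite !(boxv _ (Ordinal h)).
exists (box lo), (box hi); split => //.
  move=> mu /cov[g hg]; exists (enum_rank g) => i /hg.
  by rewrite !boxv enum_rankK.
rewrite (nneseries_split 0 #|T|) => [|m _]; last first.
  by rewrite lee_fin; apply: prodr_ge0 => i _; rewrite subr_ge0.
rewrite add0n (eseries0 (N := #|T|)) => [|m Tm _]; last first.
  by rewrite !boxn // (bigD1 j) //= !mxE subrr mul0r.
rewrite adde0 sumEFin lee_fin big_mkord; apply: le_trans vol.
rewrite [X in _ <= X](reindex (fun x : 'I_#|T| => enum_val x)) /=; last first.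
  by apply: onW_bij; apply: enum_val_bij.
rewrite le_eqVlt; apply/orP; left; apply/eqP.
by apply: eq_bigr => x _; rewrite !boxv.
Qed.

Lemma unit_interval_cell N (x : R) : 0 <= x <= 1 ->
  exists k : 'I_N.+1, k%:R / N.+1%:R <= x <= k.+1%:R / N.+1%:R.
Proof.
move=> /andP[x0 x1]; have N0 : (0 : R) < N.+1%:R by rewrite ltr0n.
(* The right endpoint belongs to the last closed cell; truncation would give the index N+1, out of
   range. *)
have [xe|xn] := eqVneq x 1.
  by exists ord_max; rewrite xe divff ?gt_eqF // lexx andbT ler_pdivrMr // mul1r ler_nat.
have xN : 0 <= x * N.+1%:R by rewrite mulr_ge0 // ltW.
have /andP[l1 l2] := truncn_itv xN.
have tN : (Num.trunc (x * N.+1%:R) < N.+1)%N.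
  rewrite -(ltr_nat R); apply: le_lt_trans l1 _.
  by rewrite -[ltRHS]mul1r ltr_pM2r // lt_neqAle xn.
by exists (Ordinal tN); rewrite /= ler_pdivrMr // l1 ler_pdivlMr //= ltW.
Qed.

(** As f is not constant, some j has f j != f i0, and on the hyperplane mu_j is an affine function
    of the coordinates other than i0 and j. Cutting those into N+1 cells each confines mu_j to an
    interval of length 2K/(N+1), so the boxes have total volume 2K/(N+1). *)
Lemma simplex_hyperplane_null n (f : 'I_n -> R) (i1 i2 : 'I_n) : f i1 != f i2 ->
  simplex_null (fun mu => distribution_vec mu /\ \sum_i mu 0 i * f i = 0).
Proof.
move=> f12 i0 e e0.
have [j fj] : exists j, f j != f i0.
  have [h|h] := eqVneq (f i1) (f i0); last by exists i1.
  by exists i2; rewrite -h eq_sym.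
have ji : j != i0 by apply: contraNneq fj => ->.
pose D := f j - f i0; have D0 : D != 0 by rewrite subr_eq0.
(* Eliminating mu_i0 by total mass 1 gives mu_j = c0 + sum of c_i mu_i; K bounds the change of this
   expression when each mu_i moves by at most 1. *)
pose c i := (f i0 - f i) / D; pose c0 := - f i0 / D.
pose K := \sum_(i | (i != i0) && (i != j)) `|c i|.
have K0 : 0 <= K by apply: sumr_ge0.
pose N := Num.bound (2 * K / e).
have N0 : (0 : R) < N.+1%:R by rewrite ltr0n.
(* Cells are indexed by functions on all coordinates, so that distributivity applies later. The
   values at i0 and j carry no information; only the choice 0 there gives a genuine box, and all
   others are flattened in direction j. *)
pose ok (g : {ffun 'I_n -> 'I_N.+1}) := (g i0 == ord0) && (g j == ord0).
pose mid (g : {ffun 'I_n -> 'I_N.+1}) :=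
  c0 + \sum_(i | (i != i0) && (i != j)) c i * ((g i)%:R / N.+1%:R).
pose side (s : R) (g : {ffun 'I_n -> 'I_N.+1}) i : R :=
  if i == i0 then 0 else
  if i == j then (mid g + s * (K / N.+1%:R)) *+ ok g else
  ((g i)%:R + (s + 1) / 2) / N.+1%:R.
pose lo g : 'rV[R]_n := \row_i side (-1) g i.
pose hi g : 'rV[R]_n := \row_i side 1 g i.
(* The volume of the box of g is the product of the [W i (g i)], so the sum over g becomes a product
   of sums: 1 at i0, 2K/(N+1) at j, and 1 at every other coordinate. *)
pose W i (x : 'I_N.+1) : R :=
  if i == i0 then (x == ord0)%:R else
  if i == j then (x == ord0)%:R * (2 * K / N.+1%:R) else N.+1%:R^-1.
have diff g i : hi g 0 i - lo g 0 i =
  if i == i0 then 0 else if i == j then (2 * K / N.+1%:R) *+ ok g else N.+1%:R^-1.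
  rewrite !mxE /side; case: eqP => _; first by rewrite subr0.
  case: eqP => _; last by field; rewrite nat1r gt_eqF.
  by case: (ok g); rewrite ?mulr0n ?subrr // !mulr1n; field; rewrite nat1r gt_eqF.
apply: (@finite_boxes_null _ _ _ j _ _ lo hi) => //.
- move=> g i; rewrite -subr_ge0 diff; case: eqP => // _.
  case: eqP => _; last by rewrite invr_ge0 ltW.
  by case: (ok g); rewrite ?mulr0n // mulr1n divr_ge0 ?mulr_ge0 // ltW.
- move=> mu [[mu0 mu1] muf].
  have mu01 i : 0 <= mu 0 i <= 1.
    by rewrite mu0 -mu1 (bigD1 i) //= lerDl sumr_ge0.
  have [h hP] := choice (fun i => unit_interval_cell N (mu01 i)).
  pose g : {ffun 'I_n -> 'I_N.+1} :=
    [ffun i => if (i == i0) || (i == j) then ord0 else h i].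
  have okg : ok g by rewrite /ok !ffunE !eqxx orbT.
  exists g => i ii0; rewrite !mxE /side (negPf ii0) okg.
  have muj : mu 0 j = c0 + \sum_(i | (i != i0) && (i != j)) c i * mu 0 i.
    have m0 : mu 0 i0 = 1 - mu 0 j - \sum_(i | (i != i0) && (i != j)) mu 0 i.
      by rewrite -mu1 (bigD1 i0) //= (bigD1 j) //=; ring.
    have s0 : mu 0 i0 * f i0 + mu 0 j * f j
              + \sum_(i | (i != i0) && (i != j)) mu 0 i * f i = 0.
      by move: muf; rewrite (bigD1 i0) //= (bigD1 j) //= addrA.
    have s1 : \sum_(i | (i != i0) && (i != j)) c i * mu 0 i
      = (f i0 * (\sum_(i | (i != i0) && (i != j)) mu 0 i)
        - \sum_(i | (i != i0) && (i != j)) mu 0 i * f i) / D.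
      rewrite mulr_sumr -sumrB mulr_suml; apply: eq_bigr => l _.
      by rewrite /c; field.
    apply: (mulIf D0); rewrite s1 mulrDl /c0 !divfK // /D.
    by move: s0; rewrite m0 => s0; lra.
  case: eqP => [->|/eqP ij]; last first.
    rewrite ffunE (negPf ii0) (negPf ij) /=; have := hP i.
    rewrite addNr mul0r addr0 => /andP[-> h2] /=; apply: le_trans h2 _.
    by rewrite ler_pM2r ?invr_gt0 // -natr1; lra.
  rewrite !mulr1n muj /mid -!addrA !lerD2l.
  have dist : `|\sum_(i | (i != i0) && (i != j)) c i * mu 0 i
      - \sum_(i | (i != i0) && (i != j)) c i * ((g i)%:R / N.+1%:R)|
      <= K / N.+1%:R.
    rewrite -sumrB mulr_suml; apply: le_trans (ler_norm_sum _ _ _) _.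
    apply: ler_sum => l /andP[l0 lj]; rewrite -mulrBr normrM ler_wpM2l //.
    rewrite ffunE (negPf l0) (negPf lj) /=; have /andP[h1 h2] := hP l.
    rewrite ger0_norm ?subr_ge0 // lerBlDl -[leRHS]/(_ + _).
    by apply: le_trans h2 _; rewrite -natr1 mulrDl mul1r.
  move: dist; rewrite ler_norml; move: (K / N.+1%:R) => q /andP[d1 d2].
  by apply/andP; split; lra.
have -> : \sum_g \prod_(i < n | i != i0) (hi g 0 i - lo g 0 i)
          = \sum_(g : {ffun 'I_n -> 'I_N.+1}) \prod_i W i (g i).
  apply: eq_bigr => g _; rewrite [RHS](bigD1 i0) //=.
  rewrite (bigD1 j) //= [X in _ = _ * X](bigD1 j) //=.
  rewrite diff mulrA /W eqxx (negPf ji) eqxx; congr (_ * _).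
    by rewrite /ok; case: (g i0 == ord0); case: (g j == ord0);
       rewrite /= ?(mulr1n, mulr0n, mul1r, mul0r, mulr0).
  by apply: eq_bigr => i /andP[a b]; rewrite diff (negPf a) (negPf b).
rewrite -bigA_distr_bigA (bigD1 i0) //= (bigD1 j) //= [X in _ * (_ * X)]big1 => [|i /andP[a b]]; last first.
  rewrite /W (negPf a) (negPf b) sumr_const card_ord -[LHS]mulr_natr mulVf ?gt_eqF //.
rewrite /W eqxx (negPf ji) eqxx mulr1 -mulr_suml.
have -> : \sum_(x : 'I_N.+1) ((x == ord0)%:R : R) = 1.
  by rewrite (bigD1 ord0) //= big1 ?addr0 // => x /negPf->.
rewrite !mul1r ler_pdivrMr // [leRHS]mulrC -ler_pdivrMr //.
have /archi_boundP/ltW h : 0 <= 2 * K / e by rewrite divr_ge0 ?mulr_ge0 // ltW.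
by apply: le_trans h _; rewrite ler_nat.
Qed.

End NullHyperplane.

(** * Reversible walks with a sign symmetry *)

Section ReversibleWalk.
Local Open Scope classical_set_scope.
Variable R : realType.
Variables (n p q : nat) (P : 'M[R]_n) (A : 'M[R]_p) (N : 'M[R]_q).
(** The columns of [K] and [L] stand for orthonormal families of even and odd functions, and [s] is
    the unit vector [w] seen on the states. By [PE], conjugation by [s] turns the walk into the
    symmetric matrix [M] below. *)
Variables (K : 'M[R]_(n, p)) (L : 'M[R]_(n, q)) (s : 'I_n -> R) (w : 'rV[R]_p).
Variables (iota : 'I_n -> 'I_n) (r : R).
Hypotheses (KK : K^T *m K = 1%:M) (LL : L^T *m L = 1%:M) (KL : K^T *m L = 0).
Hypotheses (s_gt0 : forall i, 0 < s i) (sK : forall i, s i = (w *m K^T) 0 i).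
Hypothesis w1 : sqnorm w = 1.
Hypothesis PE : forall i j,
  P i j = (s i)^-1 * (K *m A *m K^T - L *m N *m L^T) i j * s j.
Hypothesis P_ge0 : forall i j, 0 <= P i j.
Hypotheses (iotaK : involutive iota) (s_iota : forall i, s (iota i) = s i).
Hypothesis K_iota : forall i a, K (iota i) a = K i a.
Hypothesis L_iota : forall i a, L (iota i) a = - L i a.
Hypotheses (symA : A^T = A) (symN : N^T = N) (wA : w *m A = w).
Hypothesis r01 : 0 < r < 1.
Let A1 := A - w^T *m w.
Hypothesis evA : forall y, eigenvalue A1 y -> 0 <= y <= r.
Hypothesis evN : forall y, eigenvalue N y -> 0 <= y <= r.
Hypothesis r_attained : eigenvalue A1 r \/ eigenvalue N r.

Let M := K *m A *m K^T - L *m N *m L^T.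
Let LK : L^T *m K = 0.
Proof. by rewrite -[LHS]trmxK trmx_mul trmxK KL trmx0. Qed.
Let ww : w *m w^T = 1%:M.
Proof. by rewrite sqnormE w1. Qed.
Let symA1 : A1^T = A1.
Proof. by rewrite linearB /= symA trmx_mul trmxK. Qed.
Let wA1 : w *m A1 = 0.
Proof. by rewrite mulmxBr wA mulmxA ww mul1mx subrr. Qed.
Let sM : (w *m K^T) *m M = w *m K^T.
Proof.
rewrite /M mulmxBr !mulmxA -(mulmxA w K^T K) KK mulmx1 wA.
by rewrite -(mulmxA w K^T L) KL mulmx0 !mul0mx subr0.
Qed.
Let r0 : 0 < r. Proof. by case/andP: r01. Qed.

(** [A1] and the projection w^T w annihilate each other, so their powers do not mix. The exponent
    starts at 1: for 0 the formula would read 1 = 1 + w^T w. *)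
Lemma deflated_pow t : A ^+ t.+1 = A1 ^+ t.+1 + w^T *m w.
Proof.
elim: t => [|t IH]; first by rewrite !expr1 subrK.
rewrite exprS IH [in RHS]exprS -[A * _]/(A *m _) -[A1 * _]/(A1 *m _).
have {1}-> : A = A1 + w^T *m w by rewrite subrK.
rewrite mulmxDl; congr (_ + _).
  rewrite mulmxDr (_ : A1 *m (w^T *m w) = 0) ?addr0 //.
  by rewrite mulmxA -[X in X *m w]trmxK trmx_mul trmxK symA1 wA1 trmx0 mul0mx.
rewrite exprS -[A1 * _]/(A1 *m _) mulmxDr !mulmxA -(mulmxA _ w A1) wA1 mulmx0.
by rewrite mul0mx add0r -(mulmxA _ w w^T) ww mulmx1.
Qed.

(** The cross terms vanish because the even and odd columns are orthogonal. Exponent 0 is excluded,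
    since it would also require K K^T + L L^T = 1. *)
Lemma symmetrized_pow t :
  M ^+ t.+1 = K *m A ^+ t.+1 *m K^T + (-1) ^+ t.+1 *: (L *m N ^+ t.+1 *m L^T).
Proof.
elim: t => [|t IH]; first by rewrite !expr1 scaleN1r.
rewrite exprS IH [A ^+ t.+2]exprS [N ^+ t.+2]exprS [(-1) ^+ t.+2]exprS.
rewrite -[M * _]/(M *m _) -[A * _]/(A *m _) -[N * _]/(N *m _).
rewrite /M mulmxDr !mulmxBl -!scalemxAr !mulmxA.
rewrite -(mulmxA _ K^T K) KK mulmx1 -(mulmxA _ L^T K) LK mulmx0 !mul0mx subr0.
congr (_ + _); rewrite -(mulmxA _ K^T L) KL mulmx0 !mul0mx scaler0.
by rewrite -(mulmxA _ L^T L) LL mulmx1 sub0r mulN1r scaleNr.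
Qed.

Lemma walk_powE t i j : (P ^+ t) i j = (s i)^-1 * (M ^+ t) i j * s j.
Proof.
elim: t i j => [|t IH] i j.
  rewrite !expr0 (_ : (1 : 'M[R]_n) = 1%:M) // !mxE.
  case: eqP => [->|_]; rewrite ?mulr1 ?mulr0 ?mul0r // mulVf // gt_eqF //.
rewrite !exprS -[P * _]/(P *m _) -[M * _]/(M *m _) !mxE mulr_sumr mulr_suml.
apply: eq_bigr => k _; rewrite PE IH -/M; field.
by rewrite !gt_eqF.
Qed.

Lemma sum_s_sqr : \sum_i s i ^+ 2 = 1.
Proof.
have <- : sqnorm (w *m K^T) = \sum_i s i ^+ 2.
  by apply: eq_bigr => i _; rewrite sK.
have := sqnormE (w *m K^T); rewrite trmx_mul trmxK mulmxA -(mulmxA w) KK mulmx1.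
by rewrite ww => /matrixP/(_ 0 0); rewrite !mxE eqxx.
Qed.

Definition walk_pi : 'rV[R]_n := \row_i s i ^+ 2.

Lemma walk_pi_distr : distribution_vec walk_pi.
Proof.
split=> [i|]; first by rewrite mxE sqr_ge0.
by rewrite -sum_s_sqr; apply: eq_bigr => i _; rewrite mxE.
Qed.

Let nu (mu : 'rV[R]_n) : 'rV[R]_n := \row_i (mu 0 i / s i).

(** The component of [nu mu] along [w] is the total mass of mu. Hence the projection w^T w in the
    powers of [A] contributes exactly the stationary distribution. *)
Lemma nuKw mu : distribution_vec mu -> nu mu *m K *m w^T = 1%:M.
Proof.
case=> _ <-; apply/matrixP => i j; rewrite !ord1 -mulmxA -[K]trmxK -trmx_mul.
rewrite !mxE eqxx mulr1n; apply: eq_bigr => k _; rewrite !mxE.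
have -> : \sum_j0 w 0 j0 * K^T j0 k = s k by rewrite sK mxE.
by rewrite divfK // gt_eqF.
Qed.

Lemma walk_distance mu t j : distribution_vec mu ->
  (mu *m P ^+ t.+1) 0 j - walk_pi 0 j
  = s j * ((nu mu *m K *m A1 ^+ t.+1 *m K^T) 0 j
           + (-1) ^+ t.+1 * (nu mu *m L *m N ^+ t.+1 *m L^T) 0 j).
Proof.
move=> dmu.
have -> : (mu *m P ^+ t.+1) 0 j = s j * (nu mu *m M ^+ t.+1) 0 j.
  rewrite !mxE mulr_sumr; apply: eq_bigr => i _; rewrite walk_powE !mxE; ring.
set X := nu mu *m K *m _ *m _; set Y := nu mu *m L *m _ *m _.
have -> : nu mu *m M ^+ t.+1 = X + w *m K^T + (-1) ^+ t.+1 *: Y.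
  rewrite symmetrized_pow deflated_pow (mulmxDr (nu mu)) -scalemxAr (mulmxDr K).
  by rewrite mulmxDl (mulmxDr (nu mu)) !mulmxA nuKw // mul1mx.
rewrite [(X + _ + _) 0 j]mxE [(X + _) 0 j]mxE -sK [(_ *: Y) 0 j]mxE.
by rewrite [walk_pi 0 j]mxE; ring.
Qed.

Lemma cvg_mulmx_pow m (B E : 'M[R]_m) (v : 'rV[R]_m) (D : 'M[R]_(m, n)) j :
  (forall a b, (fun t => (B ^+ t) a b / r ^+ t) @ \oo --> E a b) ->
  (fun t => (v *m B ^+ t *m D) 0 j / r ^+ t) @ \oo --> (v *m E *m D) 0 j.
Proof.
move=> h.
have -> : (fun t => (v *m B ^+ t *m D) 0 j / r ^+ t)
   = (fun t => \sum_b \sum_a v 0 a * ((B ^+ t) a b / r ^+ t) * D b j).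
  apply/funext => t; rewrite mxE mulr_suml; apply: eq_bigr => b _.
  by rewrite mxE !mulr_suml; apply: eq_bigr => a _; ring.
have -> : (v *m E *m D) 0 j = \sum_b \sum_a v 0 a * E a b * D b j.
  by rewrite mxE; apply: eq_bigr => b _; rewrite mxE mulr_suml.
apply: cvg_sumr => b; apply: cvg_sumr => a.
by apply: cvgM; [apply: cvgM => //|]; exact: cvg_cst.
Qed.

Lemma walk_cvg mu j : distribution_vec mu ->
  (fun t => (mu *m P ^+ t) 0 j) @ \oo --> walk_pi 0 j.
Proof.
move=> dmu; have [E [cE _]] := psd_pow_cvg symA1 r0 evA.
have [F [cF _]] := psd_pow_cvg symN r0 evN.
have cx := @cvg_mulmx_pow _ _ _ (nu mu *m K) K^T j cE.
have cy := @cvg_mulmx_pow _ _ _ (nu mu *m L) L^T j cF.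
rewrite -(cvg_shiftS (fun t => (mu *m P ^+ t) 0 j)) /=.
set u := (X in X --> _).
(* Each decaying part is r^t or (-r)^t times a convergent sequence, so the alternating sign does no
   harm here. *)
have : (fun t => walk_pi 0 j + s j *
      (r ^+ t * ((nu mu *m K *m A1 ^+ t *m K^T) 0 j / r ^+ t)
       + (- r) ^+ t * ((nu mu *m L *m N ^+ t *m L^T) 0 j / r ^+ t))) @ \oo
    --> walk_pi 0 j + s j * (0 * (nu mu *m K *m E *m K^T) 0 j
                             + 0 * (nu mu *m L *m F *m L^T) 0 j).
  case/andP: r01 => _ r1.
  apply: cvgD; first exact: cvg_cst.
  apply: cvgM; first exact: cvg_cst.
  apply: cvgD; (apply: cvgM; last by []); apply: cvg_expr.
  - by rewrite gtr0_norm.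
  - by rewrite normrN gtr0_norm.
rewrite !mul0r addr0 mulr0 addr0 -cvg_shiftS /= {}/u.
set a := (X in (X @ _ --> _) -> _); set b := (X in _ -> (X @ _ --> _)).
suff -> : a = b by [].
apply/funext => t; rewrite /a /b.
have -> : (mu *m P ^+ t.+1) 0 j
  = walk_pi 0 j + ((mu *m P ^+ t.+1) 0 j - walk_pi 0 j) by rewrite addrC subrK.
rewrite walk_distance // [(- r) ^+ _]exprNn; congr (_ + _ * (_ + _)).
- by rewrite mulrC divfK // expf_neq0 // gt_eqF.
- by rewrite -mulrA [r ^+ _ * _]mulrC divfK // expf_neq0 // gt_eqF.
Qed.

Lemma walk_stochastic : stochastic P.
Proof.
move=> i; split=> [//|].
have symM : M^T = M.
  by rewrite /M linearB /= !trmx_mul !trmxK symA symN !mulmxA.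
under eq_bigr => j _ do rewrite PE -/M -mulrA.
rewrite -mulr_sumr; have -> : \sum_j M i j * s j = s i.
  rewrite sK -[in RHS]sM mxE; apply: eq_bigr => j _.
  by rewrite -sK mulrC -[in RHS]symM [M^T j i]mxE.
by rewrite mulVf // gt_eqF.
Qed.

(** Started at i, the walk converges to [walk_pi], whose entries s_j^2 are positive. *)
Lemma walk_eventually_pos i j : \forall t \near \oo, 0 < (P ^+ t) i j.
Proof.
have d : distribution_vec (delta_mx 0 i : 'rV[R]_n).
  split=> [k|]; first by rewrite mxE ler0n.
  rewrite (bigD1 i) //= mxE !eqxx big1 ?addr0 // => k ki.
  by rewrite mxE (negPf ki) andbF.
have := @walk_cvg _ j d.
have -> : (fun t => ((delta_mx 0 i : 'rV[R]_n) *m P ^+ t) 0 j) = (fun t => (P ^+ t) i j).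
  by apply/funext => t; rewrite -rowE mxE.
by move=> /cvgr_gt; apply; rewrite mxE exprn_gt0.
Qed.

Lemma walk_irreducible : irreducible P.
Proof.
by move=> i j; have [t _ h] := walk_eventually_pos i j; exists t; apply: h => /=.
Qed.

(** Two consecutive integers are return times, and a common divisor of both is 1. *)
Lemma walk_aperiodic : aperiodic P.
Proof.
move=> i d h; have [t _ ht] := walk_eventually_pos i i.
have h1 : (d %| t.+1)%N by apply: h => //; apply: ht => /=.
have h2 : (d %| t.+2)%N by apply: h => //; apply: ht => /=; rewrite ltnW.
by apply/eqP; rewrite -dvdn1 -(dvdn_addr _ h1) addn1.
Qed.

Lemma walk_stationary : stationary P walk_pi.
Proof.
split; first exact: walk_pi_distr.
apply/rowP => j; rewrite !mxE.
transitivity (s j * \sum_i s i * M i j).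
  rewrite mulr_sumr; apply: eq_bigr => i _; rewrite mxE PE -/M; field.
  by rewrite gt_eqF.
rewrite expr2; congr (_ * _); rewrite sK -[in RHS]sM mxE.
by apply: eq_bigr => i _; rewrite sK.
Qed.

Lemma walk_stationary_uniq mu : stationary P mu -> mu = walk_pi.
Proof.
move=> [dmu hmu]; apply/rowP => j.
have fix_ t : mu *m P ^+ t = mu.
  elim: t => [|t IH]; first by rewrite expr0 mulmx1.
  by rewrite exprS -[P * _]/(P *m _) mulmxA hmu.
have := @walk_cvg _ j dmu.
have -> : (fun t => (mu *m P ^+ t) 0 j) = (fun=> mu 0 j).
  by apply/funext => t; rewrite fix_.
by move=> /cvg_lim <- //; rewrite lim_cst.
Qed.

(* The sign $(-1)^t$ of the odd part is absorbed by [iota], which fixes the even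
   part and negates the odd one; this is why the limit exists even if both parts
   decay at the same rate. *)
Lemma walk_tv mu t : distribution_vec mu ->
  tv_dist (mu *m P ^+ t.+1) walk_pi
  = 2^-1 * \sum_j s j * `|(nu mu *m K *m A1 ^+ t.+1 *m K^T) 0 j
                          + (nu mu *m L *m N ^+ t.+1 *m L^T) 0 j|.
Proof.
move=> dmu; rewrite /tv_dist; congr (_ * _).
set X := nu mu *m K *m _ *m _; set Y := nu mu *m L *m _ *m _.
transitivity (\sum_j s j * `|X 0 j + (-1) ^+ t.+1 * Y 0 j|).
  by apply: eq_bigr => j _; rewrite walk_distance // normrM gtr0_norm.
case: (boolP (odd t.+1)) => ot; last first.
  by apply: eq_bigr => j _; rewrite -signr_odd (negPf ot) expr0 mul1r.
rewrite [LHS](reindex_inj (inv_inj iotaK)); apply: eq_bigr => j _ /=.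
rewrite s_iota -signr_odd ot expr1 mulN1r; congr (_ * `|_ + _|).
  by rewrite !mxE; apply: eq_bigr => a _; rewrite ![_^T _ _]mxE K_iota.
rewrite !mxE -sumrN; apply: eq_bigr => a _.
by rewrite ![_^T _ _]mxE L_iota mulrN opprK.
Qed.

(** From an eigenvector v at r, take f = (v K^T) / s or (v L^T) / s. As [E] or [F] fixes v, the
    pairing of mu with f factors through the limit and vanishes with it. If the even f were
    constant, v would be a multiple of [w], which [A1] kills although r > 0; the odd f changes sign
    under [iota], so it is constant only if zero. *)
Lemma test_function : exists f : 'I_n -> R,
  (exists i1 i2, f i1 != f i2) /\
  forall (E : 'M[R]_p) (F : 'M[R]_q) (mu : 'rV[R]_n),
    (forall v : 'rV_p, v *m A1 = r *: v -> E *m v^T = v^T) ->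
    (forall v : 'rV_q, v *m N = r *: v -> F *m v^T = v^T) ->
    nu mu *m K *m E = 0 -> nu mu *m L *m F = 0 -> \sum_i mu 0 i * f i = 0.
Proof.
have sumE m (D : 'M[R]_(n, m)) (v : 'rV[R]_m) (mu : 'rV[R]_n) :
    \sum_i mu 0 i * ((v *m D^T) 0 i / s i) = (nu mu *m D *m v^T) 0 0.
  rewrite -mulmxA -[D in RHS]trmxK -trmx_mul [RHS]mxE; apply: eq_bigr => i _.
  by rewrite [nu mu 0 i]mxE [(_ *m _)^T _ _]mxE; ring.
case: r_attained => /eigenvalueP[v hv nz].
- exists (fun i => (v *m K^T) 0 i / s i); split; last first.
    by move=> E F mu hE _ z _; rewrite sumE -hE // mulmxA z mul0mx mxE.
  apply: contrapT => h; have {}h i k : (v *m K^T) 0 i / s i = (v *m K^T) 0 k / s k.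
    by apply/eqP; apply: contrapT => /negP hn; apply: h; exists i, k.
  have vK : v = v *m K^T *m K by rewrite -mulmxA KK mulmx1.
  have [i _] : exists i, (v *m K^T) 0 i != 0.
    apply: contrapT => hz; move/negP: nz; apply; apply/eqP; rewrite vK.
    suff -> : v *m K^T = 0 by rewrite mul0mx.
    apply/rowP => k; rewrite [RHS]mxE; apply: contrapT => hk; apply: hz.
    by exists k; apply/eqP.
  have vw : v = ((v *m K^T) 0 i / s i) *: w.
    rewrite {1}vK -[w]mulmx1 -KK mulmxA scalemxAl; congr (_ *m _).
    apply/rowP => k; rewrite [RHS]mxE (h i k) -sK divfK // gt_eqF //.
  move/negP: nz; apply; have : r *: v = 0 by rewrite -hv vw -scalemxAl wA1 scaler0.
  by move/eqP; rewrite scaler_eq0 gt_eqF.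
exists (fun i => (v *m L^T) 0 i / s i); split; last first.
  by move=> E F mu _ hF _ z; rewrite sumE -hF // mulmxA z mul0mx mxE.
apply: contrapT => h; have {}h i k : (v *m L^T) 0 i / s i = (v *m L^T) 0 k / s k.
  by apply/eqP; apply: contrapT => /negP hn; apply: h; exists i, k.
have vL : v = v *m L^T *m L by rewrite -mulmxA LL mulmx1.
move/negP: nz; apply; apply/eqP; rewrite vL.
suff -> : v *m L^T = 0 by rewrite mul0mx.
apply/rowP => k; rewrite [RHS]mxE.
have odd_k : (v *m L^T) 0 (iota k) = - (v *m L^T) 0 k.
  rewrite !mxE -sumrN; apply: eq_bigr => a _.
  by rewrite ![_^T _ _]mxE L_iota mulrN.
have := h k (iota k); rewrite odd_k s_iota => /(congr1 (fun z => z * s k)).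
by rewrite !divfK ?gt_eqF // => /eqP; rewrite -addr_eq0 -mulr2n mulrn_eq0 => /eqP.
Qed.

Lemma walk_convergence_rate : convergence_rate P r.
Proof.
split=> //; exists walk_pi; split.
- exact: walk_stationary.
- exact: walk_stationary_uniq.
have [E [cE pE]] := psd_pow_cvg symA1 r0 evA.
have [F [cF pF]] := psd_pow_cvg symN r0 evN.
have [f [[i1 [i2 f12]] hf]] := test_function.
move=> i0 e e0; have [a [b [ab cov vol]]] := simplex_hyperplane_null f12 i0 e0.
exists a, b; split=> // mu [dmu nQ]; apply: cov; split=> //.
pose X := nu mu *m K *m E *m K^T; pose Y := nu mu *m L *m F *m L^T.
pose c := 2^-1 * \sum_j s j * `|X 0 j + Y 0 j|.
have c0 : 0 <= c.
  by rewrite mulr_ge0 ?invr_ge0 ?ler0n // sumr_ge0 // => j _; rewrite mulr_ge0 // ltW.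
have cc : (fun t : nat => tv_dist (mu *m P ^+ t) walk_pi / r ^+ t) @ \oo --> c.
  rewrite -(cvg_shiftS (fun t => tv_dist (mu *m P ^+ t) walk_pi / r ^+ t)) /=.
  have : (fun t => 2^-1 * \sum_j s j *
      `|(nu mu *m K *m A1 ^+ t *m K^T) 0 j / r ^+ t
        + (nu mu *m L *m N ^+ t *m L^T) 0 j / r ^+ t|) @ \oo --> c.
    apply: cvgM; first exact: cvg_cst.
    apply: cvg_sumr => j; apply: cvgM; first exact: cvg_cst.
    apply: cvg_norm; apply: cvgD; exact: cvg_mulmx_pow.
  rewrite -cvg_shiftS /=.
  set u := (X in (X @ _ --> _) -> _); set v := (X in _ -> (X @ _ --> _)).
  suff -> : u = v by [].
  apply/funext => t; rewrite /u /v walk_tv // -mulrA; congr (_ * _).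
  rewrite mulr_suml; apply: eq_bigr => j _; rewrite -mulrDl normrM mulrA.
  by rewrite normfV [`|r ^+ _|]gtr0_norm ?exprn_gt0.
(* A distribution in the exceptional set must have limit constant 0. Then the even and odd limits
   cancel, hence vanish separately by orthogonality, and mu lies on the hyperplane of f. *)
have [cpos|cz] : 0 < c \/ c = 0.
  by move: c0; rewrite le_eqVlt => /orP[/eqP<-|]; [right|left].
  by exfalso; apply: nQ; exists c.
have XY : X + Y = 0.
  apply/rowP => j; rewrite !mxE; move/eqP: cz.
  rewrite mulf_eq0 invr_eq0 pnatr_eq0 /= psumr_eq0 => [|k _]; last first.
    by rewrite mulr_ge0 // ltW.
  move=> /allP/(_ j (mem_index_enum j)); rewrite mulf_eq0 gt_eqF //= normr_eq0.
  by move=> /eqP; rewrite ![in X in X -> _]mxE.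
apply: (hf E F mu) => //.
- have := congr1 (mulmx^~ K) XY; rewrite mulmxDl mul0mx /X /Y.
  by rewrite -(mulmxA _ K^T K) KK mulmx1 -(mulmxA _ L^T K) LK mulmx0 addr0.
- have := congr1 (mulmx^~ L) XY; rewrite mulmxDl mul0mx /X /Y.
  by rewrite -(mulmxA _ L^T L) LL mulmx1 -(mulmxA _ K^T L) KL mulmx0 add0r.
Qed.

End ReversibleWalk.

(** * The rate determined by a pair of Gram matrices *)

Section GramRate.
Variable R : realType.

Lemma eigenvalueN n (A : 'M[R]_n) x : eigenvalue (- A) x = eigenvalue A (- x).
Proof.
apply/eigenvalueP/eigenvalueP => -[v hv nz]; exists v => //.
  by rewrite scaleNr -hv mulmxN opprK.
by rewrite mulmxN hv scaleNr opprK.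
Qed.

Lemma gram_sym m n (B : 'M[R]_(m, n)) : (B *m B^T)^T = B *m B^T.
Proof. by rewrite trmx_mul trmxK. Qed.

Lemma gram_eq0 m n (B : 'M[R]_(m, n)) : B *m B^T = 0 -> B = 0.
Proof.
move=> h; apply/row_matrixP => i; rewrite row0; apply/eqP.
rewrite -sqnorm_eq0 rowE.
have := sqnorm_mul (delta_mx 0 i : 'rV[R]_m) B.
rewrite h mulmx0 mul0mx => /matrixP/(_ 0 0); rewrite !mxE eqxx mulr1n.
by move=> <-.
Qed.

(** This makes the convergence rate positive: if no eigenvalue of -B B^T were negative, the
    semidefinite B B^T would have spectrum {0}, hence vanish, and [B] with it. *)
Lemma lambda_min_gram_lt0 m n (B : 'M[R]_(m, n)) : (0 < m)%N -> B != 0 ->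
  lambda_min (- (B *m B^T)) < 0.
Proof.
move=> m0; rewrite ltNge; apply: contra => l0; apply/eqP/gram_eq0.
have symN : (- (B *m B^T))^T = - (B *m B^T) by rewrite linearN /= gram_sym.
have [_ mn] := lambda_minP symN m0.
have [Q [d [QQ AE]]] := sym_spectral (gram_sym B).
have -> : B *m B^T = Q^T *m diag_mx d *m Q by [].
suff -> : d = 0.
  by rewrite (_ : diag_mx 0 = 0) ?mulmx0 ?mul0mx //; apply/matrixP => i j;
     rewrite !mxE mul0rn.
apply/rowP => i; rewrite mxE.
have ev : eigenvalue (B *m B^T) (d 0 i).
  rewrite -mem_eigvals (perm_mem (perm_eigvals_diag QQ AE)).
  by apply/mapP; exists i; rewrite ?mem_enum.
apply/le_anti; rewrite (eigen_gram_ge0 ev) andbT -oppr_ge0.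
by apply: le_trans l0 (mn _ _); rewrite eigenvalueN opprK.
Qed.

(** Subtracting w^T w replaces the simple eigenvalue 1 by 0 and leaves the rest of the spectrum
    alone, so the largest eigenvalue that survives in the even part is [lambda_max1]. *)
Lemma gram_rate p p' q q' (B : 'M[R]_(p, p')) (S : 'M[R]_(q, q')) (w : 'rV[R]_p) :
  (1 < p)%N -> (0 < q)%N -> sqnorm w = 1 -> w *m (B *m B^T) = w ->
  (forall y, eigenvalue (B *m B^T) y -> y <= 1) ->
  (forall f, f *m (B *m B^T) = f -> exists c, f = c *: w) ->
  S != 0 -> -1 < lambda_min (- (S *m S^T)) ->
  let r := Num.max (lambda_max1 (B *m B^T)) (- lambda_min (- (S *m S^T))) in
  [/\ 0 < r < 1,
      forall y, eigenvalue (B *m B^T - w^T *m w) y -> 0 <= y <= r,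
      forall y, eigenvalue (S *m S^T) y -> 0 <= y <= r
    & eigenvalue (B *m B^T - w^T *m w) r \/ eigenvalue (S *m S^T) r].
Proof.
move=> p1 q0 w1 wA le1 un S0 l1 r; set A := B *m B^T.
have symA : A^T = A := gram_sym B.
have w0 : w != 0 by rewrite -sqnorm_eq0 w1 oner_eq0.
have ww : w *m w^T = 1%:M by rewrite sqnormE w1.
have mu1 : mup 1 (char_poly A) = 1%N.
  by apply: (simple_mup symA w0); rewrite ?scale1r // => f; rewrite scale1r; apply: un.
have [a1 ea mxa] := lambda_max1_lt symA p1 le1 mu1.
have symN : (- (S *m S^T))^T = - (S *m S^T) by rewrite linearN /= gram_sym.
have [eb mnb] := lambda_minP symN q0.
have b0 := lambda_min_gram_lt0 q0 S0.
have ar : lambda_max1 A <= r by rewrite le_max lexx.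
have br : - lambda_min (- (S *m S^T)) <= r by rewrite le_max lexx orbT.
split.
- apply/andP; split; first by apply: lt_le_trans br; rewrite oppr_gt0.
  by rewrite /r gt_max a1 ltrNl.
- move=> y /eigenvalueP[v hv nz]; have [->|y0] := eqVneq y 0.
    by rewrite lexx /= (le_trans _ br) // oppr_ge0 ltW.
  (* An eigenvector of the deflated matrix for y != 0 is orthogonal to w, hence an eigenvector of
     [A]; y = 1 is then impossible, as it would make v a multiple of w. *)
  have vw : v *m w^T = 0.
    have : y *: (v *m w^T) = 0.
      rewrite scalemxAl -hv -mulmxA mulmxBl -{1}symA -trmx_mul wA -mulmxA ww mulmx1.
      by rewrite subrr mulmx0.
    by move/eqP; rewrite scaler_eq0 (negPf y0) => /eqP.
  have vA : v *m A = y *: v.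
    by rewrite -hv mulmxBr (mulmxA v w^T) vw mul0mx subr0.
  have ev : eigenvalue A y by apply/eigenvalueP; exists v.
  rewrite (eigen_gram_ge0 ev) /=; apply: le_trans ar; apply: mxa => //.
  apply/eqP => y1; move: vA; rewrite y1 scale1r => /un[c vc].
  move: vw; rewrite vc -scalemxAl ww => /matrixP/(_ 0 0); rewrite !mxE eqxx mulr1.
  by move=> c0; move: nz; rewrite vc c0 scale0r eqxx.
- move=> y ev; rewrite (eigen_gram_ge0 ev) /=; apply: le_trans br.
  by rewrite lerNr; apply: mnb; rewrite eigenvalueN opprK.
rewrite /r maxEle; case: ifP => _; [right|left].
  by rewrite -eigenvalueN.
case/eigenvalueP: ea => v hv nz; apply/eigenvalueP; exists v => //.
have vw : v *m w^T = 0.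
  apply: (@sym_eigen_orth _ _ _ _ _ _ 1 symA hv); rewrite ?lt_eqF //.
  by rewrite wA scale1r.
by rewrite mulmxBr (mulmxA v w^T) vw mul0mx subr0.
Qed.

End GramRate.

(** * Components of the quotient graph *)

Lemma connect_ind (T : finType) (e : rel T) (P : T -> Prop) x y :
  (forall a b, P a -> e a b -> P b) -> connect e x y -> P x -> P y.
Proof.
move=> h /connectP[p pp ->]; elim: p x pp => //= a p IH x /andP[xa pa] Px.
by apply: IH pa _; apply: h Px xa.
Qed.

Section Components.
Variables (T : finType) (e : rel T) (S : {set T}).
Hypothesis sym_e : symmetric e.

Lemma component_connect (C : {set T}) a b : component e S C ->
  a \in C -> b \in C -> connect [rel x y | [&& x \in C, y \in C & e x y]] a b.
Proof.
case/maxsetP => /andP[_ /andP[_ /forallP h]] _ aC bC.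
by have /implyP/(_ aC)/forallP/(_ b)/implyP/(_ bC) := h a.
Qed.

Lemma component_sub (C : {set T}) : component e S C -> C \subset S.
Proof. by case/maxsetP => /andP[]. Qed.

Lemma component_neq0 (C : {set T}) : component e S C -> exists a, a \in C.
Proof. by case/maxsetP => /andP[_ /andP[/set0Pn]]. Qed.

Lemma component_closed (C : {set T}) a b : component e S C ->
  a \in C -> b \in S -> e a b -> b \in C.
Proof.
move=> cC aC bS eab; case/maxsetP: (cC) => _ mx.
have <- : b |: C = C; last by rewrite !inE eqxx.
apply: mx; last exact: finset.subsetUr.
have CS := component_sub cC; apply/andP; split.
  by apply/fintype.subsetP => x; rewrite !inE => /predU1P[->//|]; apply: (fintype.subsetP CS).
apply/andP; split; first by apply/set0Pn; exists a; rewrite !inE aC orbT.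
pose B := b |: C; pose r := [rel x y | [&& x \in B, y \in B & e x y]].
have sr : connect_sym r.
  by apply: sym_connect_sym => x y /=; rewrite sym_e andbCA.
have ax x : x \in B -> connect r a x.
  rewrite !inE => /predU1P[->|xC].
    by apply: connect1; rewrite /= !inE aC eqxx orbT eab.
  apply: connect_sub (component_connect cC aC xC) => y z /=.
  case/and3P => yC zC eyz; apply: connect1.
  by rewrite /= !inE yC zC !orbT eyz.
apply/forallP => x; apply/implyP => xB; apply/forallP => y; apply/implyP => yB.
by apply: connect_trans (ax y yB); rewrite sr; apply: ax.
Qed.

Lemma closed_component (D : {set T}) : D \subset S -> connected_set e D ->
  (forall a b, a \in D -> b \in S -> e a b -> b \in D) -> component e S D.
Proof.
move=> DS cD cl; apply/maxsetP; split; first by rewrite DS.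
move=> B /andP[BS /andP[_ /forallP cB]] DB; apply/eqP; rewrite finset.eqEsubset DB andbT.
apply/fintype.subsetP => b bB; case/andP: cD => /set0Pn[d dD] _.
have dB := fintype.subsetP DB _ dD.
have /implyP/(_ dB)/forallP/(_ b)/implyP/(_ bB) := cB d.
move=> /(connect_ind (P := fun x => x \in D)); apply => // x y xD /and3P[_ yB exy].
by apply: cl xD _ exy; apply: (fintype.subsetP BS).
Qed.

End Components.

(** * Passage between a double cover and its quotient *)

Section Quotient.
Variable G : double_cover.
Implicit Types (a b c : qnode G) (u v : G).

Lemma up_adj_sym : symmetric (@up_adj G).
Proof.
move=> a b; rewrite /up_adj [b == a]eq_sym [qdim b == qdim a]eq_sym.
case: (a != b) => //=; case: eqP => //= ->.
by apply: eq_existsb => c; rewrite [qedge a c && _]andbC.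
Qed.

Lemma LP_gt0 a : (0 < LP a)%N.
Proof.
rewrite /LP; elim: #|_| a => [|n IH] a //=; case: ifP => // /negbFE/existsP[b ab].
by rewrite (bigD1 b) //= ltn_addr.
Qed.

Lemma RP_gt0 a : (0 < RP a)%N.
Proof.
rewrite /RP; elim: #|_| a => [|n IH] a //=; case: ifP => // /negbFE/existsP[b ab].
by rewrite (bigD1 b) //= ltn_addr.
Qed.

Lemma qedge_opp u v : dc_edge (dc_opp u) v = dc_edge u v.
Proof. by rewrite -!qedge_qn qn_opp. Qed.

Lemma qedge_oppr u v : dc_edge u (dc_opp v) = dc_edge u v.
Proof. by rewrite -!qedge_qn qn_opp. Qed.

Variable O : qnode G -> G.
Hypothesis orO : orientation O.

Lemma qn_or a : qn (O a) = a.
Proof. exact/esym/qnP/orO. Qed.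

Lemma or_inj : injective O.
Proof. by move=> a b /(congr1 (@qn G)); rewrite !qn_or. Qed.

Lemma or_cases u : u = O (qn u) \/ u = dc_opp (O (qn u)).
Proof.
have := orO (qn u); rewrite mem_qn => /orP[]/eqP->; first by left.
by right; rewrite dc_oppK.
Qed.

Lemma edge_or a c : dc_edge (O a) (O c) = qedge a c.
Proof. by rewrite -qedge_qn !qn_or. Qed.

Lemma qn_eqE a u : (qn u == a) = (u == O a) || (u == dc_opp (O a)).
Proof.
apply/eqP/orP => [<-|[]/eqP->]; rewrite ?qn_opp ?qn_or //.
by case: (or_cases u) => e; [left|right]; rewrite -e.
Qed.

Lemma flip_orientation (f : qnode G -> bool) :
  orientation (fun a => if f a then O a else dc_opp (O a)).
Proof.
move=> a; case: ifP => _; first exact: orO.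
by rewrite {2}(qnP (orO a)) mem_qn eqxx orbT.
Qed.

Lemma sum_nodes (R : realType) (F : G -> R) :
  \sum_u F u = \sum_a (F (O a) + F (dc_opp (O a))).
Proof.
rewrite (partition_big (@qn G) predT) //=; apply: eq_bigr => a _.
rewrite (eq_bigl (fun u => (u == O a) || (u == dc_opp (O a)))); last first.
  by move=> u; rewrite -qn_eqE.
rewrite (bigD1 (O a)) ?eqxx //=; congr (_ + _).
rewrite (bigD1 (dc_opp (O a))) /= ?eqxx ?orbT ?dc_opp_neq //.
rewrite big1 ?addr0 // => u /andP[/andP[/orP[]/eqP->]]; rewrite eqxx //.
Qed.

Lemma sum_lift (R : realType) (X : {set qnode G}) (F : G -> R) :
  \sum_(u in lift_set X) F u = \sum_(a in X) (F (O a) + F (dc_opp (O a))).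
Proof.
rewrite big_mkcond sum_nodes [RHS]big_mkcond; apply: eq_bigr => a _.
by rewrite !inE qn_opp qn_or; case: ifP; rewrite ?addr0.
Qed.

End Quotient.

(** * An up-component, the down-component above it, and coherence *)

Section UpComponent.
Variables (G : double_cover) (k : int) (C : {set qnode G}) (O : qnode G -> G).
Hypotheses (strongG : strong_grading G) (compC : up_component (k - 1) C).
Hypotheses (nleafC : ~ single_leaf C) (ncohC : ~ up_coherent C).
Hypothesis orO : orientation O.
Implicit Types (a b c : qnode G) (u v : G).
Let D := nodes_above k C.

Lemma qedge_dimS a b : qedge a b -> qdim b = qdim a + 1.
Proof.
case/existsP => u /andP[/qnP-> /existsP[v /andP[/qnP->]]] /strongG.
by rewrite !qdim_qn.
Qed.

Lemma upC_dim a : a \in C -> qdim a = k - 1.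
Proof. by move/(fintype.subsetP (component_sub compC)); rewrite inE => /eqP. Qed.

Lemma up_adjI a b c : a != b -> qedge a c -> qedge b c -> up_adj a b.
Proof.
move=> ab ac bc; have := qedge_dimS ac; have := qedge_dimS bc => -> e.
rewrite /up_adj ab -(inj_eq (addIr 1)) e eqxx; apply/existsP; exists c.
by rewrite ac bc (qedge_dimS ac) eqxx.
Qed.

Lemma down_adjI a b c : a != b -> qedge c a -> qedge c b -> down_adj a b.
Proof.
move=> ab ac bc; rewrite /down_adj ab (qedge_dimS ac) (qedge_dimS bc) eqxx.
by apply/existsP; exists c; rewrite ac bc addrK eqxx.
Qed.

(** A leaf has no up-neighbour, so a component containing one is reduced to it. *)
Lemma upC_nleaf a : a \in C -> ~~ qleaf a.
Proof.
move=> aC; apply/negP => la; apply: nleafC; exists a => //.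
apply/setP => b; rewrite inE; apply/idP/eqP => [bC|->//].
have := component_connect compC aC bC.
move=> /(connect_ind (P := fun x => x = a)); apply => // x y -> /and3P[_ _].
case/and3P => _ _ /existsP[c /and3P[_ ac _]].
by case/negP: la; apply/existsP; exists c.
Qed.

Lemma mem_above c : (c \in D) = [exists a in C, qedge a c].
Proof.
rewrite !inE andb_idl // => /existsP[a /andP[aC ac]].
by rewrite (qedge_dimS ac) (upC_dim aC) subrK.
Qed.

Lemma aboveI a c : a \in C -> qedge a c -> c \in D.
Proof. by move=> aC ac; rewrite mem_above; apply/existsP; exists a; rewrite aC. Qed.

Lemma aboveP c : c \in D -> exists2 a, a \in C & qedge a c.
Proof. by rewrite mem_above => /existsP[a /andP[]]; exists a. Qed.

Lemma upC_closed a b c : a \in C -> qedge a c -> qedge b c -> b \in C.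
Proof.
move=> aC ac bc; have [<-//|ab] := eqVneq a b.
apply: (component_closed (@up_adj_sym G) compC aC); last exact: up_adjI ab ac bc.
rewrite inE -(upC_dim aC); apply/eqP/(addIr 1).
by rewrite -(qedge_dimS ac) -(qedge_dimS bc).
Qed.

(** With this, edges between dimensions k-1 and k that touch C or [D] join C to [D], so the path
    recursions restricted to C and [D] lose no term. *)
Lemma below_above b c : c \in D -> qedge b c -> b \in C.
Proof. by case/aboveP => a aC ac; apply: upC_closed aC ac. Qed.

Lemma upC_ind (P : qnode G -> Prop) a b : a \in C -> b \in C -> P a ->
  (forall x y c, x \in C -> y \in C -> c \in D -> qedge x c -> qedge y c -> P x -> P y) ->
  P b.
Proof.
move=> aC bC Pa h; have := component_connect compC aC bC.
move=> /(connect_ind (P := P)); apply => // x y Px /and3P[xC yC].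
case/and3P => _ _ /existsP[c /and3P[_ xc yc]].
by apply: (h x y c) => //; apply: aboveI xc.
Qed.

Lemma above_component : down_component k D.
Proof.
apply: closed_component; first by apply/fintype.subsetP => c; rewrite inE => /andP[].
  apply/andP; split.
    have [a aC] := component_neq0 compC.
    have /negPn/existsP[c ac] := upC_nleaf aC.
    by apply/set0Pn; exists c; apply: aboveI ac.
  apply/forallP => c; apply/implyP => cD; apply/forallP => c'; apply/implyP => cD'.
  set r := [rel x y | _].
  have step a x y : x \in D -> y \in D -> qedge a x -> qedge a y -> connect r x y.
    move=> xD yD ax ay; have [<-//|xy] := eqVneq x y.
    by apply: connect1; rewrite /= xD yD; apply: down_adjI xy ax ay.
  have [a aC ac] := aboveP cD; have [a' aC' ac'] := aboveP cD'.
  (* Connectedness of C is transported upwards: along C, all nodes above the current node remain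
     reachable from c, since two nodes above the same node are down-adjacent or equal. *)
  pose P x := forall z, qedge x z -> connect r c z.
  have Pa' : P a'.
    apply: (upC_ind aC aC').
      by move=> z az; apply: (step a) => //; apply: aboveI az.
    move=> x y d xC yC dD xd yd Px z yz; apply: connect_trans (Px d xd) _.
    by apply: (step y) => //; apply: aboveI yz.
  exact: Pa'.
move=> c c' cD _ /and3P[_ _ /existsP[t /and3P[_ tc tc']]].
by apply: aboveI tc'; apply: below_above tc.
Qed.

Lemma above_nroot c : c \in D -> ~~ qroot c.
Proof. by case/aboveP => a _ ac; apply/negPn/existsP; exists a. Qed.

(** Orienting both levels so that all signs are 1 suffices: the sign at an arbitrary lift v then
    depends only on whether v is the chosen lift or its opposite. *)
Lemma coherentI (O1 O2 : qnode G -> G) : orientation O1 -> orientation O2 ->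
  (forall a c, a \in C -> qedge a c -> dc_sign (O2 c) (O1 a) = 1) -> up_coherent C.
Proof.
move=> or1 or2 h; split=> //; exists O1 => // u u' v /imsetP[a aC ->] /imsetP[b bC ->].
have sg x : x \in C -> dc_edge (O1 x) v -> dc_sign v (O1 x) = if v == O2 (qn v) then 1 else -1.
  move=> xC ev; have xv : qedge x (qn v) by rewrite -(qn_or or1 x) qedge_qn.
  case: eqP => [->|ne]; first by rewrite h.
  case: (or_cases or2 v) => // {1}->; rewrite dc_sign_oppl ?h //.
  by rewrite -qedge_qn !qn_or.
by move=> av bv; rewrite !sg.
Qed.

Lemma sign_or a c : qedge a c ->
  dc_sign (O c) (O a) = 1 \/ dc_sign (O c) (O a) = -1.
Proof. by move=> ac; apply: dc_sign_pm1; rewrite edge_or. Qed.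

(** For a coherent orientation of [D], the sign between a fixed lift of a in C and the oriented
    nodes above it is independent of the latter; flipping that lift where the sign is -1 makes C
    coherent. *)
Lemma above_ncoherent : ~ down_coherent D.
Proof.
case=> _ [sO or2 h]; apply: ncohC.
pose f a := [exists c, [&& c \in D, qedge a c & dc_sign (sO c) (O a) == 1]].
apply: (coherentI (flip_orientation orO f) or2) => a c aC ac /=.
have cD := aboveI aC ac.
have e x : qedge a x -> dc_edge (O a) (sO x) by move=> ax; rewrite -qedge_qn !qn_or.
case: ifP => [/existsP[d /and3P[dD ad /eqP <-]]|nf].
  by apply: h; rewrite ?imset_f // e.
rewrite dc_sign_oppr ?e //; case: (dc_sign_pm1 (e _ ac)) => s; last by rewrite s opprK.
by case/negP: (negbT nf); apply/existsP; exists c; rewrite cD ac s eqxx.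
Qed.

(** On a one-element set that is not a single leaf, every orientation is coherent. *)
Lemma card_upC : (1 < #|C|)%N.
Proof.
rewrite ltnNge; apply/negP => c1; apply: ncohC; split=> //; exists O => //.
move=> u u' v /imsetP[a aC ->] /imsetP[b bC ->] _ _.
by have -> : a = b by apply: (card_le1_eqP c1).
Qed.

(** If only one node c lay above C, each node of C could be oriented to have sign 1 towards the lift
    of c. *)
Lemma card_above : (1 < #|D|)%N.
Proof.
rewrite ltnNge; apply/negP => d1; apply: ncohC.
have [c cD] := component_neq0 above_component.
apply: (coherentI (flip_orientation orO (fun a => dc_sign (O c) (O a) == 1)) orO).
move=> a d aC ad /=; have -> : d = c by apply: (card_le1_eqP d1) => //; apply: aboveI ad.
have ac : qedge a c by rewrite (_ : c = d) //; apply: (card_le1_eqP d1) => //; apply: aboveI ad.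
case: ifP => [/eqP//|]; case: (sign_or ac) => s; first by rewrite s eqxx.
by rewrite dc_sign_oppr ?edge_or // s opprK.
Qed.

Lemma above_nsingle_root : ~ single_root D.
Proof.
case=> c rc eD; have : c \in D by rewrite eD inE.
by move/above_nroot; rewrite rc.
Qed.

(** The signs of such an h would be a coherent orientation: flip the lift of a by the sign of h a,
    and the lift of c by the sign of the value shared by all nodes below c. *)
Lemma no_coherent_weight (R : realType) (h : qnode G -> R) :
  (forall a, a \in C -> h a != 0) ->
  ~ (forall a b c, a \in C -> b \in C -> c \in D -> qedge a c -> qedge b c ->
      (dc_sign (O c) (O a))%:~R * h a = (dc_sign (O c) (O b))%:~R * h b).
Proof.
move=> h0 hc; apply: ncohC.
pose f c := [exists a in C, qedge a c && (0 < (dc_sign (O c) (O a))%:~R * h a)].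
apply: (coherentI (flip_orientation orO (fun a => 0 < h a)) (flip_orientation orO f)).
move=> a c aC ac /=; have cD := aboveI aC ac.
have fE : f c = (0 < (dc_sign (O c) (O a))%:~R * h a).
  apply/existsP/idP => [[b /and3P[bC bc]]|p]; last by exists a; rewrite aC ac.
  by rewrite (hc b a c).
have ha := h0 a aC; have eac : dc_edge (O a) (O c) by rewrite edge_or.
have eac' : dc_edge (dc_opp (O a)) (O c) by rewrite qedge_opp.
rewrite fE; case: (sign_or ac) => s; rewrite s ?mulr1z ?mulrN1z ?mul1r ?mulN1r.
  case: ifP => p; rewrite ?dc_sign_oppl ?dc_sign_oppr ?s ?opprK //.
rewrite oppr_gt0; case: (ltrgtP (h a) 0) => p.
- by rewrite dc_sign_oppr ?s ?opprK.
- by rewrite dc_sign_oppl ?s ?opprK.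
- by rewrite p eqxx in ha.
Qed.

End UpComponent.

(** * Even and odd functions on the double cover *)

Lemma enum_orP (G : double_cover) (O : qnode G -> G) (X : {set qnode G})
    (i : 'I_#|O @: X|) : exists2 a, a \in X & enum_val i = O a.
Proof. by have /imsetP[a aX e] := enum_valP i; exists a. Qed.

Section LiftedWalk.
Variables (R : realType) (G : double_cover) (O : qnode G -> G).
Hypothesis orO : orientation O.
Variable X : {set qnode G}.
Let n := #|lift_set X|.
Let p := #|X|.
Let q := #|O @: X|.

Let c2 : R := Num.sqrt 2.
Let c2_gt0 : 0 < c2. Proof. by rewrite sqrtr_gt0 ltr0n. Qed.
Let c2_sqr : c2 * c2 = 2. Proof. by rewrite -expr2 sqr_sqrtr ?ler0n. Qed.
Let c2V_sqr : c2^-1 * c2^-1 = 2^-1. Proof. by rewrite -invfM c2_sqr. Qed.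

(** The factor 1/sqrt 2 normalizes the columns, as each class has two lifts. *)
Definition even_mx : 'M[R]_(n, p) :=
  \matrix_(i, a) ((qn (enum_val i) == enum_val a)%:R / c2).

Definition osign (u o : G) : R := (u == o)%:R - (u == dc_opp o)%:R.

Definition odd_mx : 'M[R]_(n, q) :=
  \matrix_(i, o) (osign (enum_val i) (enum_val o) / c2).

Lemma lift_qn (i : 'I_n) : qn (enum_val i) \in X.
Proof. by have := enum_valP i; rewrite inE. Qed.

Lemma osign_or a b : osign (O a) (O b) = (a == b)%:R.
Proof.
rewrite /osign (inj_eq (or_inj orO)) [X in _ - X](_ : _ = 0) ?subr0 //.
rewrite (_ : (O a == dc_opp (O b)) = false) //; apply/eqP => e.
have ab : a = b by move/(congr1 (@qn G)): e; rewrite qn_opp !qn_or.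
by have := dc_opp_neq (O b); rewrite -e ab eqxx.
Qed.

Lemma osign_opp u o : osign (dc_opp u) o = - osign u o.
Proof.
rewrite /osign opprB (inj_eq (inv_inj (@dc_oppK G))).
by rewrite -(inj_eq (inv_inj (@dc_oppK G)) _ o) dc_oppK.
Qed.

Lemma sum_even (F : qnode G -> R) b : b \in X ->
  \sum_(a : 'I_p) (b == enum_val a)%:R * F (enum_val a) = F b.
Proof.
move=> bX; rewrite -(big_enum_val (fun a => (b == a)%:R * F a)) (bigD1 b) //=.
rewrite eqxx mul1r big1 ?addr0 // => a /andP[_ /negPf]; rewrite eq_sym => ->.
by rewrite mul0r.
Qed.

Lemma sum_odd (F : G -> R) u : qn u \in X -> (forall v, F (dc_opp v) = - F v) ->
  \sum_(o : 'I_q) osign u (enum_val o) * F (enum_val o) = F u.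
Proof.
move=> uX oddF; rewrite -(big_enum_val (fun o => osign u o * F o)).
rewrite big_imset => [|a b _ _]; last exact: or_inj.
have e a : osign (O (qn u)) (O a) * F (O a) = (qn u == a)%:R * F (O a).
  by rewrite osign_or.
case: (or_cases orO u) => [e1|e1].
  rewrite (eq_bigr (fun a => (qn u == a)%:R * F (O a))) => [|a _]; last first.
    by rewrite {1}e1 e.
  rewrite (bigD1 (qn u)) //= eqxx mul1r -e1 big1 ?addr0 // => a /andP[_ /negPf].
  by rewrite eq_sym => ->; rewrite mul0r.
rewrite (eq_bigr (fun a => - ((qn u == a)%:R * F (O a)))) => [|a _]; last first.
  by rewrite {1}e1 osign_opp mulNr e.
rewrite (bigD1 (qn u)) //= eqxx mul1r -oddF -e1 big1 ?addr0 // => a /andP[_ /negPf].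
by rewrite eq_sym => ->; rewrite mul0r oppr0.
Qed.

Lemma even_orthonormal : even_mx^T *m even_mx = 1%:M.
Proof.
apply/matrixP => a b; rewrite !mxE.
under eq_bigr => i _ do rewrite !mxE.
rewrite -(big_enum_val (fun u => (qn u == enum_val a)%:R / c2
   * ((qn u == enum_val b)%:R / c2))) (sum_lift orO) /=.
rewrite (eq_bigr (fun x => (enum_val a == x)%:R * ((x == enum_val b)%:R : R))).
  rewrite (bigD1 (enum_val a)) ?enum_valP //= eqxx mul1r big1 ?addr0.
    by rewrite (inj_eq enum_val_inj).
  by move=> x /andP[_ /negPf]; rewrite eq_sym => ->; rewrite mul0r.
move=> x _; rewrite qn_opp !qn_or // [enum_val a == x]eq_sym.
have -> : forall y z : R, y / c2 * (z / c2) + y / c2 * (z / c2)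
   = y * z * (2 * (c2^-1 * c2^-1)) by move=> y z; ring.
by rewrite c2V_sqr mulfV ?mulr1 // pnatr_eq0.
Qed.

Lemma odd_orthonormal : odd_mx^T *m odd_mx = 1%:M.
Proof.
apply/matrixP => a b; rewrite !mxE.
under eq_bigr => i _ do rewrite !mxE.
rewrite -(big_enum_val (fun u => osign u (enum_val a) / c2
   * (osign u (enum_val b) / c2))) (sum_lift orO) /=.
have [a' aX ea] := enum_orP a; have [b' bX eb] := enum_orP b.
have -> : (a == b) = (a' == b').
  by rewrite -(inj_eq enum_val_inj) ea eb (inj_eq (or_inj orO)).
rewrite ea eb (eq_bigr (fun x => (a' == x)%:R * ((x == b')%:R : R))).
  rewrite (bigD1 a') //= eqxx mul1r big1 ?addr0 //.
  by move=> x /andP[_ /negPf]; rewrite eq_sym => ->; rewrite mul0r.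
move=> x _; rewrite !osign_opp !osign_or [a' == x]eq_sym.
have -> : forall y z : R, y / c2 * (z / c2) + - y / c2 * (- z / c2)
   = y * z * (2 * (c2^-1 * c2^-1)) by move=> y z; ring.
by rewrite c2V_sqr mulfV ?mulr1 // pnatr_eq0.
Qed.

Lemma even_odd_orthogonal : even_mx^T *m odd_mx = 0.
Proof.
apply/matrixP => a b; rewrite !mxE.
under eq_bigr => i _ do rewrite !mxE.
rewrite -(big_enum_val (fun u => (qn u == enum_val a)%:R / c2
   * (osign u (enum_val b) / c2))) (sum_lift orO) /= big1 // => x _.
by rewrite osign_opp qn_opp mulNr mulrN subrr.
Qed.

Lemma even_conj (A : qnode G -> qnode G -> R) i j :
  (even_mx *m principal X A *m even_mx^T) i j
  = 2^-1 * A (qn (enum_val i)) (qn (enum_val j)).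
Proof.
rewrite mxE -c2V_sqr.
transitivity (\sum_(b : 'I_p) (qn (enum_val j) == enum_val b)%:R
    * (c2^-1 * c2^-1 * A (qn (enum_val i)) (enum_val b))).
  apply: eq_bigr => b _; rewrite !mxE.
  have -> : \sum_a even_mx i a * principal X A a b
      = c2^-1 * A (qn (enum_val i)) (enum_val b).
    rewrite -(sum_even (fun a => A a (enum_val b)) (lift_qn i)) mulr_sumr.
    by apply: eq_bigr => a _; rewrite !mxE; ring.
  ring.
by rewrite (sum_even (fun b => c2^-1 * c2^-1 * A _ b) (lift_qn j)).
Qed.

Lemma odd_conj (A : G -> G -> R) i j :
  (forall u v, A (dc_opp u) v = - A u v) -> (forall u v, A u (dc_opp v) = - A u v) ->
  (odd_mx *m principal (O @: X) A *m odd_mx^T) i j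
  = 2^-1 * A (enum_val i) (enum_val j).
Proof.
move=> oddl oddr; rewrite mxE -c2V_sqr.
transitivity (\sum_(b : 'I_q) osign (enum_val j) (enum_val b)
    * (c2^-1 * c2^-1 * A (enum_val i) (enum_val b))).
  apply: eq_bigr => b _; rewrite !mxE.
  have -> : \sum_a odd_mx i a * principal (O @: X) A a b
      = c2^-1 * A (enum_val i) (enum_val b).
    rewrite -(sum_odd (F := fun a => A a (enum_val b)) (lift_qn i)) //.
    by rewrite mulr_sumr; apply: eq_bigr => a _; rewrite !mxE; ring.
  ring.
by rewrite (sum_odd (F := fun b => c2^-1 * c2^-1 * A _ b) (lift_qn j)) // => v;
   rewrite oddr mulrN.
Qed.

Definition opp_index (i : 'I_n) : 'I_n :=
  enum_rank_in (enum_valP i) (dc_opp (enum_val i)).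

Lemma opp_indexE i : enum_val (opp_index i) = dc_opp (enum_val i).
Proof. by rewrite enum_rankK_in // inE qn_opp lift_qn. Qed.

Lemma opp_indexK : involutive opp_index.
Proof. by move=> i; apply: enum_val_inj; rewrite !opp_indexE dc_oppK. Qed.

Variables (p' q' : nat) (B : 'M[R]_(p, p')) (S : 'M[R]_(q, q')).
Variables (A : qnode G -> qnode G -> R) (AO W : G -> G -> R) (x : qnode G -> R).
Hypotheses (AE : principal X A = B *m B^T) (AOE : principal (O @: X) AO = - (S *m S^T)).
Hypotheses (oddl : forall u v, AO (dc_opp u) v = - AO u v)
  (oddr : forall u v, AO u (dc_opp v) = - AO u v).
Hypothesis x_gt0 : forall a, 0 < x a.
Let w0 : 'rV[R]_p := \row_i x (enum_val i).
Hypothesis w0A : w0 *m (B *m B^T) = w0.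
Hypothesis le1 : forall y, eigenvalue (B *m B^T) y -> y <= 1.
Hypothesis un : forall f, f *m (B *m B^T) = f -> exists c, f = c *: w0.
Hypotheses (cX : (1 < #|X|)%N) (S0 : S != 0).
Hypothesis l1 : -1 < lambda_min (- (S *m S^T)).
Hypothesis W_ge0 : forall u v, 0 <= W u v.
Hypothesis WE : forall u v, qn u \in X -> qn v \in X ->
  W u v = (x (qn u))^-1 * (2^-1 * (A (qn u) (qn v) + AO u v)) * x (qn v).

(** The even part of the symmetrized walk is [A] and the odd part is [AO], each acting through its
    isometric embedding; the factor 1/2 in [WE] is the square of the normalization of these
    embeddings. *)
Lemma lifted_walk :
  let P := principal (lift_set X) W in
  [/\ stochastic P, irreducible P, aperiodic P
    & convergence_rate P (Num.max (lambda_max1 (B *m B^T))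
                                  (- lambda_min (- (S *m S^T))))].
Proof.
pose z := Num.sqrt (sqnorm w0).
have p0 : (0 < p)%N by rewrite /p (leq_trans _ cX).
have w00 : w0 != 0.
  apply/eqP => /rowP/(_ (Ordinal p0)); rewrite !mxE => e.
  by have := x_gt0 (enum_val (Ordinal p0)); rewrite e ltxx.
have z0 : 0 < z by rewrite sqrtr_gt0 sqnorm_gt0.
pose w := z^-1 *: w0.
have w1 : sqnorm w = 1.
  have -> : sqnorm w = z^-1 ^+ 2 * sqnorm w0.
    by rewrite mulr_sumr; apply: eq_bigr => i _; rewrite [w 0 i]mxE exprMn.
  by rewrite exprVn sqr_sqrtr ?sqnorm_ge0 // mulVf // sqnorm_eq0.
have wA : w *m (B *m B^T) = w by rewrite -scalemxAl w0A.
have un' f : f *m (B *m B^T) = f -> exists c, f = c *: w.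
  move=> /un[c ->]; exists (c * z); rewrite scalerA -mulrA divff ?mulr1 //.
  by rewrite gt_eqF.
have q0 : (0 < q)%N by rewrite /q card_imset //; exact: or_inj.
have [r01 evA evN att] := gram_rate cX q0 w1 wA le1 un' S0 l1.
(* [z] normalizes the weights on the quotient, and the extra factor sqrt 2 accounts for the two
   lifts of each class. *)
pose s (i : 'I_n) : R := x (qn (enum_val i)) / (z * c2).
have zc : 0 < z * c2 by rewrite mulr_gt0.
have s_gt0 i : 0 < s i by rewrite divr_gt0.
have sK i : s i = (w *m even_mx^T) 0 i.
  rewrite mxE; transitivity (\sum_(a : 'I_p) (qn (enum_val i) == enum_val a)%:R
      * (x (enum_val a) / (z * c2))).
    by rewrite (sum_even (fun a => x a / (z * c2)) (lift_qn i)).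
  apply: eq_bigr => a _; rewrite !mxE; field.
  by rewrite !gt_eqF.
pose P := principal (lift_set X) W.
have PE i j : P i j = (s i)^-1 * (even_mx *m (B *m B^T) *m even_mx^T
     - odd_mx *m (S *m S^T) *m odd_mx^T) i j * s j.
  rewrite -AE -[S *m S^T]opprK -AOE mulmxN mulNmx opprK.
  rewrite [X in _ * X * _]mxE even_conj odd_conj // mxE WE ?lift_qn // /s.
  by field; rewrite !gt_eqF.
have P_ge0 i j : 0 <= P i j by rewrite mxE.
have K_i i a : even_mx (opp_index i) a = even_mx i a.
  by rewrite !mxE opp_indexE qn_opp.
have L_i i a : odd_mx (opp_index i) a = - odd_mx i a.
  by rewrite !mxE opp_indexE osign_opp mulNr.
have s_i i : s (opp_index i) = s i by rewrite /s opp_indexE qn_opp.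
have symA := gram_sym B; have symN := gram_sym S.
have KK := even_orthonormal; have LL := odd_orthonormal.
have KL := even_odd_orthogonal.
split.
- exact: (walk_stochastic KK KL s_gt0 sK PE P_ge0 symA symN wA).
- exact: (walk_irreducible KK LL KL s_gt0 sK w1 PE symA symN wA r01 evA evN).
- exact: (walk_aperiodic KK LL KL s_gt0 sK w1 PE symA symN wA r01 evA evN).
- exact: (walk_convergence_rate KK LL KL s_gt0 sK w1 PE opp_indexK s_i
    K_i L_i symA symN wA r01 evA evN att).
Qed.

End LiftedWalk.

(** * Incidence matrices *)

Section Factorization.
Variables (R : realType) (G : double_cover) (k : int).
Variables (C : {set qnode G}) (O : qnode G -> G).
Hypotheses (strongG : strong_grading G) (compC : up_component (k - 1) C).
Hypotheses (nleafC : ~ single_leaf C) (ncohC : ~ up_coherent C).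
Hypothesis orO : orientation O.
Implicit Types (a b c : qnode G) (u v : G).
Let D := nodes_above k C.

Let l a : R := Num.sqrt (LP a)%:R.
Let r a : R := Num.sqrt (RP a)%:R.
Let l_gt0 a : 0 < l a. Proof. by rewrite sqrtr_gt0 ltr0n LP_gt0. Qed.
Let r_gt0 a : 0 < r a. Proof. by rewrite sqrtr_gt0 ltr0n RP_gt0. Qed.
Let l_neq0 a : l a != 0. Proof. by rewrite gt_eqF. Qed.
Let r_neq0 a : r a != 0. Proof. by rewrite gt_eqF. Qed.
Let LPl a : (LP a)%:R = l a ^+ 2. Proof. by rewrite sqr_sqrtr ?ler0n. Qed.
Let RPr a : (RP a)%:R = r a ^+ 2. Proof. by rewrite sqr_sqrtr ?ler0n. Qed.
Let sqrtH a : Num.sqrt (LPRP R a) = l a / r a.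
Proof. by rewrite /LPRP sqrtrM ?ler0n // sqrtrV ?ler0n. Qed.
Let HE a : LPRP R a = l a ^+ 2 / r a ^+ 2.
Proof. by rewrite /LPRP LPl RPr. Qed.

(** The square root of LP * RP, which counts the maximal chains through the node. *)
Definition path_weight a : R := l a * r a.
Local Notation x := path_weight.

Lemma path_weight_gt0 a : 0 < x a. Proof. by rewrite mulr_gt0. Qed.

(** The entry on an edge is the square root of H(c)/H(a). *)
Definition incidence a c : R := if qedge a c then (l c / r c) / (l a / r a) else 0.
Local Notation b_ := incidence.

Definition signed_incidence u v : R := (dc_sign v u)%:~R * b_ (qn u) (qn v).
Local Notation s_ := signed_incidence.

Lemma incidence_ge0 a c : 0 <= b_ a c.
Proof. by rewrite /b_; case: ifP => // _; rewrite !divr_ge0 // ltW. Qed.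

Lemma incidence_gt0 a c : qedge a c -> 0 < b_ a c.
Proof. by rewrite /b_ => ->; rewrite !divr_gt0. Qed.

Lemma norm_signed_incidence a c : `|s_ (O a) (O c)| = b_ a c.
Proof.
rewrite /s_ !qn_or // normrM [`|b_ a c|]ger0_norm ?incidence_ge0 //.
have [ac|nac] := boolP (qedge a c); last by rewrite /b_ (negPf nac) mulr0.
by case: (sign_or orO ac) => ->; rewrite ?mulrN1z ?mulr1z ?normrN normr1 mul1r.
Qed.

(** The term of a is RP(a) sqrt(H(c)), so this is the recursion for RP at the non-root c, all of
    whose lower neighbours lie in C. *)
Lemma weight_incidence c : c \in D -> \sum_(a in C) x a * b_ a c = x c.
Proof.
move=> cD.
transitivity (\sum_(a | qedge a c) (RP a)%:R * (l c / r c)).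
  rewrite big_mkcond [RHS]big_mkcond; apply: eq_bigr => a _.
  rewrite /b_; case: ifP => aC; case: ifP => ac //; rewrite ?mulr0 //.
    by rewrite RPr /x; field; rewrite l_neq0 !r_neq0.
  by rewrite (below_above strongG compC cD ac) in aC.
rewrite -mulr_suml -natr_sum; have := RPE c.
rewrite (negPf (above_nroot strongG compC cD)) => <-; rewrite RPr /x; field.
exact: r_neq0.
Qed.

Lemma incidence_weight a : a \in C -> \sum_(c in D) b_ a c * x c = x a.
Proof.
move=> aC.
transitivity (\sum_(c | qedge a c) (LP c)%:R / (l a / r a)).
  rewrite big_mkcond [RHS]big_mkcond; apply: eq_bigr => c _.
  rewrite /b_; case: ifP => cD; case: ifP => ac //; rewrite ?mul0r //.
    by rewrite LPl /x; field; rewrite l_neq0 !r_neq0.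
  by rewrite (aboveI strongG compC aC ac) in cD.
rewrite -mulr_suml -natr_sum; have := LPE a.
rewrite (negPf (upC_nleaf compC nleafC aC)) => <-; rewrite LPl /x; field.
by rewrite l_neq0 r_neq0.
Qed.

Lemma sum_above a b (F : qnode G -> R) : a \in C ->
  \sum_(c | qedge a c && qedge b c) F c
  = \sum_(c in D) (if qedge a c && qedge b c then F c else 0).
Proof.
move=> aC; rewrite big_mkcond [RHS]big_mkcond; apply: eq_bigr => c _.
case: ifP => [/andP[ac bc]|]; last by rewrite if_same.
by rewrite (aboveI strongG compC aC ac).
Qed.

Lemma sum_below c d (F : qnode G -> R) : c \in D ->
  \sum_(a | qedge a c && qedge a d) F a
  = \sum_(a in C) (if qedge a c && qedge a d then F a else 0).
Proof.
move=> cD; rewrite big_mkcond [RHS]big_mkcond; apply: eq_bigr => a _.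
case: ifP => [/andP[ac bc]|]; last by rewrite if_same.
by rewrite (below_above strongG compC cD ac).
Qed.

(** By strong grading, distinct nodes below a common node are up-adjacent. Hence where the case
    distinction of [A_up] or [AO_up] leaves the first branch, the sum is empty and one formula
    covers all cases. *)
Lemma up_adj_sum a b (F : qnode G -> R) : a \in C ->
  ~~ (up_adj a b || (a == b) && ~~ qleaf a) ->
  a != b /\ \sum_(c | qedge a c && qedge b c) F c = 0.
Proof.
move=> aC; rewrite negb_or negb_and (upC_nleaf compC nleafC aC) orbF.
move=> /andP[nu ab]; split=> //; rewrite big1 // => c /andP[ac bc].
by rewrite (up_adjI strongG ab ac bc) in nu.
Qed.

Lemma down_adj_sum c d (F : qnode G -> R) : c \in D ->
  ~~ (down_adj c d || (c == d) && ~~ qroot c) ->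
  c != d /\ \sum_(a | qedge a c && qedge a d) F a = 0.
Proof.
move=> cD; rewrite negb_or negb_and (above_nroot strongG compC cD) orbF.
move=> /andP[nu cd]; split=> //; rewrite big1 // => a /andP[ac ad].
by rewrite (down_adjI strongG cd ac ad) in nu.
Qed.

Lemma A_upE a b : a \in C -> A_up R a b = \sum_(c in D) b_ a c * b_ b c.
Proof.
move=> aC; transitivity ((Num.sqrt (LPRP R a))^-1 * (Num.sqrt (LPRP R b))^-1
      * \sum_(c | qedge a c && qedge b c) LPRP R c).
  rewrite /A_up; case: ifPn => // /(up_adj_sum (@LPRP R G) aC)[ab ->].
  by rewrite (negPf ab) mulr0.
rewrite sum_above // mulr_sumr; apply: eq_bigr => c _; rewrite /b_ !sqrtH HE.
case: (qedge _ _) => /=; last by rewrite !(mulr0, mul0r).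
case: (qedge _ _) => /=; last by rewrite !(mulr0, mul0r).
by field; rewrite !l_neq0 !r_neq0.
Qed.

Lemma A_downE c d : c \in D -> A_down R c d = \sum_(a in C) b_ a c * b_ a d.
Proof.
move=> cD; transitivity (Num.sqrt (LPRP R c) * Num.sqrt (LPRP R d)
      * \sum_(a | qedge a c && qedge a d) (LPRP R a)^-1).
  rewrite /A_down; case: ifPn => // /(down_adj_sum (fun a => (LPRP R a)^-1) cD)[cd ->].
  by rewrite (negPf cd) mulr0.
rewrite sum_below // mulr_sumr; apply: eq_bigr => a _; rewrite /b_ !sqrtH HE.
case: (qedge _ _) => /=; last by rewrite !(mulr0, mul0r).
case: (qedge _ _) => /=; last by rewrite !(mulr0, mul0r).
by field; rewrite !l_neq0 !r_neq0.
Qed.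

Lemma AO_upE u v : qn u \in C ->
  AO_up R O u v = - \sum_(c in D) s_ u (O c) * s_ v (O c).
Proof.
move=> uC; transitivity (- ((Num.sqrt (LPRP R (qn u)))^-1 * (Num.sqrt (LPRP R (qn v)))^-1
      * \sum_(c | qedge (qn u) c && qedge (qn v) c)
          (dc_sign (O c) u)%:~R * (dc_sign (O c) v)%:~R * LPRP R c)).
  rewrite /AO_up; case: ifPn => // /(up_adj_sum
    (fun c => (dc_sign (O c) u)%:~R * (dc_sign (O c) v)%:~R * LPRP R c) uC)[_ ->].
  by rewrite mulr0 oppr0.
congr (- _); rewrite sum_above // mulr_sumr; apply: eq_bigr => c _.
rewrite /s_ /b_ !qn_or // !sqrtH HE.
case: (qedge _ _) => /=; last by rewrite !(mulr0, mul0r).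
case: (qedge _ _) => /=; last by rewrite !(mulr0, mul0r).
by field; rewrite !l_neq0 !r_neq0.
Qed.

Lemma AO_downE u v : qn u \in D ->
  AO_down R O u v = - \sum_(a in C) s_ (O a) u * s_ (O a) v.
Proof.
move=> uD; transitivity (- (Num.sqrt (LPRP R (qn u)) * Num.sqrt (LPRP R (qn v))
      * \sum_(c | qedge c (qn u) && qedge c (qn v))
          (dc_sign u (O c))%:~R * (dc_sign v (O c))%:~R * (LPRP R c)^-1)).
  rewrite /AO_down; case: ifPn => // /(down_adj_sum
    (fun c => (dc_sign u (O c))%:~R * (dc_sign v (O c))%:~R * (LPRP R c)^-1) uD)[_ ->].
  by rewrite mulr0 oppr0.
congr (- _); rewrite sum_below // mulr_sumr; apply: eq_bigr => a _.
rewrite /s_ /b_ !qn_or // !sqrtH HE.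
case: (qedge _ _) => /=; last by rewrite !(mulr0, mul0r).
case: (qedge _ _) => /=; last by rewrite !(mulr0, mul0r).
by field; rewrite !l_neq0 !r_neq0.
Qed.

Lemma AO_up_oddl u v : AO_up R O (dc_opp u) v = - AO_up R O u v.
Proof.
rewrite /AO_up qn_opp; case: ifP => _; last by rewrite oppr0.
rewrite opprK -mulrN -sumrN; congr (_ * _); apply: eq_bigr => c /andP[uc _].
have e : dc_edge u (O c) by rewrite -qedge_qn qn_or.
by rewrite dc_sign_oppr // mulrNz !(mulrN, mulNr) opprK.
Qed.

Lemma AO_up_oddr u v : AO_up R O u (dc_opp v) = - AO_up R O u v.
Proof.
rewrite /AO_up qn_opp; case: ifP => _; last by rewrite oppr0.
rewrite opprK -mulrN -sumrN; congr (_ * _); apply: eq_bigr => c /andP[_ vc].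
have e : dc_edge v (O c) by rewrite -qedge_qn qn_or.
by rewrite dc_sign_oppr // mulrNz !(mulrN, mulNr) opprK.
Qed.

Lemma AO_down_oddl u v : AO_down R O (dc_opp u) v = - AO_down R O u v.
Proof.
rewrite /AO_down qn_opp; case: ifP => _; last by rewrite oppr0.
rewrite opprK -mulrN -sumrN; congr (_ * _); apply: eq_bigr => c /andP[uc _].
have e : dc_edge (O c) u by rewrite -qedge_qn qn_or.
by rewrite dc_sign_oppl // mulrNz !(mulrN, mulNr) opprK.
Qed.

Lemma AO_down_oddr u v : AO_down R O u (dc_opp v) = - AO_down R O u v.
Proof.
rewrite /AO_down qn_opp; case: ifP => _; last by rewrite oppr0.
rewrite opprK -mulrN -sumrN; congr (_ * _); apply: eq_bigr => c /andP[_ vc].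
have e : dc_edge (O c) v by rewrite -qedge_qn qn_or.
by rewrite dc_sign_oppl // mulrNz !(mulrN, mulNr) opprK.
Qed.

Lemma up_walk_ge0 u v : 0 <= up_walk R u v.
Proof.
rewrite /up_walk; case: ifP => _; first by case: ifP; rewrite // invr_ge0 ler0n.
by apply: sumr_ge0 => c _; rewrite divr_ge0 // mulr_ge0 // ler0n.
Qed.

Lemma down_walk_ge0 u v : 0 <= down_walk R u v.
Proof.
rewrite /down_walk; case: ifP => _; first by case: ifP; rewrite // invr_ge0 ler0n.
by apply: sumr_ge0 => c _; rewrite divr_ge0 // mulr_ge0 // ler0n.
Qed.

(** Summed over the two lifts of a node, the sign condition of the walk becomes the indicator (1 - e
    e')/2 of opposite signs. The 1 produces the even matrix and - e e' the signed one, which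
    explains the minus sign in the latter. *)
Lemma sign_indicator (e e' : int) (y : R) : e = 1 \/ e = -1 -> e' = 1 \/ e' = -1 ->
  (if (e == 1) && (e' == -1) then y else 0)
  + (if (- e == 1) && (- e' == -1) then y else 0)
  = 2^-1 * (y * (1 - e%:~R * e'%:~R)).
Proof. by case=> -> [] -> /=; rewrite ?mulr1z ?mulrN1z; field. Qed.

Lemma up_walkE u v : qn u \in C -> qn v \in C ->
  up_walk R u v
  = (x (qn u))^-1 * (2^-1 * (A_up R (qn u) (qn v) + AO_up R O u v)) * x (qn v).
Proof.
move=> uC vC; rewrite A_upE // AO_upE // -sumrB mulr_sumr mulr_sumr mulr_suml.
rewrite /up_walk (negPf (upC_nleaf compC nleafC uC)) big_mkcond (sum_nodes orO).
rewrite [RHS]big_mkcond; apply: eq_bigr => c _.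
rewrite /s_ !qn_opp !qn_or // !qedge_oppr -!qedge_qn !qn_or //.
have [uc|nuc] := boolP (qedge (qn u) c); last first.
  by rewrite /= addr0 /b_ (negPf nuc); case: ifP => // _; rewrite !(mulr0, mul0r, subr0).
have [vc|nvc] := boolP (qedge (qn v) c); last first.
  by rewrite /= addr0 /b_ (negPf nvc); case: ifP => // _; rewrite !(mulr0, mul0r, subr0).
have eu : dc_edge u (O c) by rewrite -qedge_qn qn_or.
have ev : dc_edge v (O c) by rewrite -qedge_qn qn_or.
rewrite (aboveI strongG compC uC uc) /= !dc_sign_oppl //.
rewrite sign_indicator; [|exact: dc_sign_pm1|exact: dc_sign_pm1].
rewrite /b_ uc vc !LPl !RPr /x.
by field; rewrite !l_neq0 !r_neq0.
Qed.

Lemma down_walkE u v : qn u \in D -> qn v \in D ->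
  down_walk R u v
  = (x (qn u))^-1 * (2^-1 * (A_down R (qn u) (qn v) + AO_down R O u v)) * x (qn v).
Proof.
move=> uD vD; rewrite A_downE // AO_downE // -sumrB mulr_sumr mulr_sumr mulr_suml.
rewrite /down_walk (negPf (above_nroot strongG compC uD)) big_mkcond (sum_nodes orO).
rewrite [RHS]big_mkcond; apply: eq_bigr => c _.
rewrite /s_ !qn_opp !qn_or // !qedge_opp -!qedge_qn !qn_or //.
have [uc|nuc] := boolP (qedge c (qn u)); last first.
  by rewrite /= addr0 /b_ (negPf nuc); case: ifP => // _; rewrite !(mulr0, mul0r, subr0).
have [vc|nvc] := boolP (qedge c (qn v)); last first.
  by rewrite /= addr0 /b_ (negPf nvc); case: ifP => // _; rewrite !(mulr0, mul0r, subr0).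
have eu : dc_edge (O c) u by rewrite -qedge_qn qn_or.
have ev : dc_edge (O c) v by rewrite -qedge_qn qn_or.
rewrite (below_above strongG compC uD uc) /= !dc_sign_oppr //.
(* The down-walk asks for the signs in the opposite order, so the roles of u and v are exchanged
   before the indicator formula applies. *)
rewrite ![(_ == -1) && _]andbC sign_indicator; [|exact: dc_sign_pm1|exact: dc_sign_pm1].
rewrite /b_ uc vc !LPl !RPr /x.
by field; rewrite !l_neq0 !r_neq0.
Qed.

End Factorization.

(** * Spectra of the incidence matrices of a component *)

Section Spectra.
Variables (R : realType) (G : double_cover) (k : int).
Variables (C : {set qnode G}) (O : qnode G -> G).
Hypotheses (strongG : strong_grading G) (compC : up_component (k - 1) C).
Hypotheses (nleafC : ~ single_leaf C) (ncohC : ~ up_coherent C).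
Hypothesis orO : orientation O.
Implicit Types (a b c : qnode G).
Let D := nodes_above k C.

Local Notation x := (@path_weight R G).
Local Notation b_ := (@incidence R G).
Local Notation s_ := (@signed_incidence R G).

Definition incidence_mx : 'M[R]_(#|C|, #|D|) :=
  \matrix_(i, j) b_ (enum_val i) (enum_val j).
Definition signed_incidence_mx : 'M[R]_(#|O @: C|, #|O @: D|) :=
  \matrix_(i, j) s_ (enum_val i) (enum_val j).
Local Notation B := incidence_mx.
Local Notation S := signed_incidence_mx.

Definition weight_row (X : {set qnode G}) : 'rV[R]_#|X| := \row_i x (enum_val i).

Lemma A_up_gram : principal C (@A_up R G) = B *m B^T.
Proof.
apply/matrixP => i j; rewrite !mxE (A_upE _ strongG compC) ?enum_valP //.
by rewrite big_enum_val; apply: eq_bigr => l _; rewrite !mxE.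
Qed.

Lemma A_down_gram : principal D (@A_down R G) = B^T *m B.
Proof.
apply/matrixP => i j; rewrite !mxE (A_downE _ strongG compC) ?enum_valP //.
by rewrite big_enum_val; apply: eq_bigr => l _; rewrite !mxE.
Qed.

Lemma sum_or (X : {set qnode G}) (F : G -> R) :
  \sum_(i : 'I_#|O @: X|) F (enum_val i) = \sum_(a in X) F (O a).
Proof.
rewrite -(big_enum_val (A := mem (O @: X))) big_imset //.
by move=> a b _ _; apply: or_inj.
Qed.

Lemma AO_up_gram : principal (O @: C) (@AO_up R G O) = - (S *m S^T).
Proof.
apply/matrixP => i j; rewrite !mxE.
have [a aC ea] := enum_orP i; have [b bC eb] := enum_orP j.
rewrite (AO_upE _ strongG compC) ?ea ?qn_or //; congr (- _).
rewrite -(sum_or D (fun v => s_ (O a) v * s_ (enum_val j) v)).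
by apply: eq_bigr => l _; rewrite !mxE ea.
Qed.

Lemma AO_down_gram : principal (O @: D) (@AO_down R G O) = - (S^T *m S).
Proof.
apply/matrixP => i j; rewrite !mxE.
have [a aC ea] := enum_orP i; have [b bC eb] := enum_orP j.
rewrite (AO_downE _ strongG compC) ?ea ?qn_or //; congr (- _).
rewrite -(sum_or C (fun v => s_ v (O a) * s_ v (enum_val j))).
by apply: eq_bigr => l _; rewrite !mxE ea.
Qed.

Lemma row_incidence j : \sum_i x (enum_val i) * `|B i j| = x (enum_val j).
Proof.
rewrite -[RHS](weight_incidence R strongG compC (enum_valP j)) [RHS]big_enum_val.
by apply: eq_bigr => i _; rewrite !mxE ger0_norm ?incidence_ge0.
Qed.

Lemma incidence_col i : \sum_j `|B i j| * x (enum_val j) = x (enum_val i).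
Proof.
rewrite -[RHS](incidence_weight R strongG compC nleafC (enum_valP i)) [RHS]big_enum_val.
by apply: eq_bigr => j _; rewrite !mxE ger0_norm ?incidence_ge0.
Qed.

Lemma weight_row_incidence : weight_row C *m B = weight_row D.
Proof.
apply/rowP => j; rewrite !mxE -row_incidence; apply: eq_bigr => i _.
by rewrite !mxE ger0_norm ?incidence_ge0.
Qed.

Lemma weight_row_incidenceT : weight_row D *m B^T = weight_row C.
Proof.
apply/rowP => i; rewrite !mxE -incidence_col; apply: eq_bigr => j _.
by rewrite !mxE ger0_norm ?incidence_ge0 // mulrC.
Qed.

Lemma weight_row_up : weight_row C *m (B *m B^T) = weight_row C.
Proof. by rewrite mulmxA weight_row_incidence weight_row_incidenceT. Qed.

Lemma weight_row_down : weight_row D *m (B^T *m B) = weight_row D.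
Proof. by rewrite mulmxA weight_row_incidenceT weight_row_incidence. Qed.

Lemma weight_row_neq0 (X : {set qnode G}) : (0 < #|X|)%N -> weight_row X != 0.
Proof.
move=> X0; apply/eqP => /rowP/(_ (Ordinal X0)); rewrite !mxE => e.
by have := path_weight_gt0 R (enum_val (Ordinal X0)); rewrite e ltxx.
Qed.

Lemma up_eigenvalue_le1 y : eigenvalue (B *m B^T) y -> y <= 1.
Proof.
by apply: eigen_gram_le1 row_incidence incidence_col _ => i; apply: path_weight_gt0.
Qed.

Lemma down_eigenvalue_le1 y : eigenvalue (B^T *m B) y -> y <= 1.
Proof.
rewrite -{2}[B]trmxK.
apply: (@eigen_gram_le1 _ _ _ B^T (fun j => x (enum_val j)) (fun i => x (enum_val i))).
- by move=> j; apply: path_weight_gt0.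
- by move=> i; rewrite -incidence_col; apply: eq_bigr => j _; rewrite mxE mulrC.
- by move=> j; rewrite -row_incidence; apply: eq_bigr => i _; rewrite mxE mulrC.
Qed.

(** By the equality case of the contraction, f/x agrees at any two nodes below a common node, and
    connectedness of C spreads this to all of C. *)
Lemma up_eigenvector1 (f : 'rV[R]_#|C|) :
  f *m (B *m B^T) = f -> exists z, f = z *: weight_row C.
Proof.
move=> hf; have [a0 a0C] := component_neq0 compC.
pose i0 := enum_rank_in a0C a0.
exists (f 0 i0 / x a0); apply/rowP => i; rewrite !mxE.
suff -> : f 0 i0 / x a0 = f 0 i / x (enum_val i).
  by rewrite divfK // gt_eqF // path_weight_gt0.
pose P a := forall l, enum_val l = a -> f 0 i0 / x a0 = f 0 l / x a.
have : P (enum_val i); last by apply.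
apply: (upC_ind strongG compC a0C (enum_valP i)).
  move=> l el; have -> : l = i0 by apply: enum_val_inj; rewrite enum_rankK_in.
  by [].
move=> a b c aC bC cD ac bc Pa l el.
have ea : enum_val (enum_rank_in a0C a) = a by rewrite enum_rankK_in.
have ec : enum_val (enum_rank_in cD c) = c by rewrite enum_rankK_in.
have gtB y z : enum_val y = z -> qedge z c -> 0 < B y (enum_rank_in cD c).
  by move=> ey zc; rewrite mxE ey ec incidence_gt0.
have gt0 i' := path_weight_gt0 R (@enum_val _ (mem C) i').
have := contraction_gram_eq gt0 row_incidence incidence_col hf
   (lt0r_neq0 (gtB _ _ ea ac)) (lt0r_neq0 (gtB _ _ el bc)).
rewrite !gtr0_sg ?(gtB _ _ ea ac) ?(gtB _ _ el bc) // !mul1r ea el => <-.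
exact: Pa.
Qed.

(** Multiplication by B^T carries fixed vectors of B^T B to fixed vectors of B B^T, and f = (f B^T)
    B recovers f. *)
Lemma down_eigenvector1 (f : 'rV[R]_#|D|) :
  f *m (B^T *m B) = f -> exists z, f = z *: weight_row D.
Proof.
move=> hf; have [z hz] : exists z, f *m B^T = z *: weight_row C.
  by apply: up_eigenvector1; rewrite mulmxA -(mulmxA f) hf.
by exists z; rewrite -hf mulmxA hz -scalemxAl weight_row_incidence.
Qed.

Lemma signed_row j :
  \sum_i x (qn (enum_val i)) * `|S i j| = x (qn (enum_val j)).
Proof.
have [c cD ec] := enum_orP j; rewrite ec qn_or //.
rewrite -[RHS](weight_incidence R strongG compC cD).
transitivity (\sum_(i : 'I_#|O @: C|) x (qn (enum_val i)) * `|s_ (enum_val i) (O c)|).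
  by apply: eq_bigr => i _; rewrite mxE ec.
rewrite (sum_or C (fun u => x (qn u) * `|s_ u (O c)|)).
by apply: eq_bigr => a _; rewrite qn_or // norm_signed_incidence.
Qed.

Lemma signed_col i :
  \sum_j `|S i j| * x (qn (enum_val j)) = x (qn (enum_val i)).
Proof.
have [a aC ea] := enum_orP i; rewrite ea qn_or //.
rewrite -[RHS](incidence_weight R strongG compC nleafC aC).
transitivity (\sum_(j : 'I_#|O @: D|) `|s_ (O a) (enum_val j)| * x (qn (enum_val j))).
  by apply: eq_bigr => j _; rewrite mxE ea.
rewrite (sum_or D (fun v => `|s_ (O a) v| * x (qn v))).
by apply: eq_bigr => c _; rewrite qn_or // norm_signed_incidence.
Qed.

(** The equality case makes h = f/x compatible with the signs along common upper nodes. If h is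
    nonzero at one node it is nonzero on all of C, and its signs then give a coherent
    orientation. *)
Lemma signed_eigenvector1 (f : 'rV[R]_#|O @: C|) :
  f *m (S *m S^T) = f -> f = 0.
Proof.
move=> hf; apply: contrapT => f0; have [a0 a0C] := component_neq0 compC.
have o0 : O a0 \in O @: C by apply: imset_f.
pose ix a := enum_rank_in o0 (O a).
have ixE a : a \in C -> enum_val (ix a) = O a.
  by move=> aC; rewrite enum_rankK_in // imset_f.
pose h a := f 0 (ix a) / x a.
have hE a b c : a \in C -> b \in C -> c \in D -> qedge a c -> qedge b c ->
    (dc_sign (O c) (O a))%:~R * h a = (dc_sign (O c) (O b))%:~R * h b.
  move=> aC bC cD ac bc; have oc : O c \in O @: D by apply: imset_f.
  pose j := enum_rank_in oc (O c).
  have ej : enum_val j = O c by rewrite enum_rankK_in.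
  have Sj z : z \in C -> S (ix z) j = (dc_sign (O c) (O z))%:~R * b_ z c.
    by move=> zC; rewrite mxE ixE // ej /signed_incidence !qn_or.
  have S0 z : z \in C -> qedge z c -> S (ix z) j != 0.
    move=> zC zc; rewrite Sj //; apply: mulf_neq0; last by rewrite gt_eqF ?incidence_gt0.
    by case: (sign_or orO zc) => ->; rewrite ?mulrN1z ?mulr1z ?oppr_eq0 oner_eq0.
  have sgS z : z \in C -> qedge z c -> Num.sg (S (ix z) j) = (dc_sign (O c) (O z))%:~R.
    move=> zC zc; rewrite Sj // sgrM (gtr0_sg (incidence_gt0 R zc)) mulr1.
    by case: (sign_or orO zc) => ->; rewrite ?mulrN1z ?mulr1z ?sgrN sgr1.
  have gt0 i' := path_weight_gt0 R (qn (@enum_val _ (mem (O @: C)) i')).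
  have := contraction_gram_eq gt0 signed_row signed_col hf (S0 _ aC ac) (S0 _ bC bc).
  by rewrite !sgS // !ixE // !qn_or.
apply: (no_coherent_weight strongG compC nleafC ncohC orO (h := h)) => //.
have [i fi] : exists i, f 0 i != 0.
  apply: contrapT => hz; apply: f0; apply/rowP => i; rewrite mxE.
  by apply: contrapT => hi; apply: hz; exists i; apply/eqP.
have [a1 a1C e1] := enum_orP i.
have h1 : h a1 != 0.
  apply: mulf_neq0; last by rewrite invr_eq0 gt_eqF ?path_weight_gt0.
  by rewrite (_ : ix a1 = i) //; apply: enum_val_inj; rewrite ixE.
move=> a aC; apply: (upC_ind (P := fun a => is_true (h a != 0)) strongG compC a1C aC h1) => y z c yC zC cD yc zc hy.
have := hE _ _ _ yC zC cD yc zc.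
apply: contra_eq_neq => ->; rewrite mulr0 mulf_neq0 //.
by case: (sign_or orO yc) => ->; rewrite ?mulrN1z ?mulr1z ?oppr_eq0 oner_eq0.
Qed.

Lemma signed_neq0 : S != 0.
Proof.
have [a aC] := component_neq0 compC.
have /negPn/existsP[c ac] := upC_nleaf compC nleafC aC.
have cD := aboveI strongG compC aC ac.
have oa : O a \in O @: C by apply: imset_f.
have oc : O c \in O @: D by apply: imset_f.
apply/eqP => /matrixP/(_ (enum_rank_in oa (O a)) (enum_rank_in oc (O c))).
rewrite !mxE !enum_rankK_in // => /eqP; rewrite -normr_eq0 norm_signed_incidence //.
by rewrite gt_eqF // incidence_gt0.
Qed.

Lemma card_orC : (0 < #|O @: C|)%N.
Proof.
rewrite card_imset; first exact: ltnW (card_upC nleafC ncohC orO).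
exact: or_inj.
Qed.

Lemma signed_lambda_min : -1 < lambda_min (- (S *m S^T)).
Proof.
have symN : (- (S *m S^T))^T = - (S *m S^T) by rewrite linearN /= gram_sym.
have [ev _] := lambda_minP symN card_orC.
rewrite eigenvalueN in ev; rewrite ltrNl lt_neqAle; apply/andP; split.
  apply/eqP => e; move: ev; rewrite e => /eigenvalueP[f hf /negP]; apply.
  by apply/eqP/signed_eigenvector1; rewrite hf scale1r.
exact: (eigen_gram_le1 (fun i => path_weight_gt0 R _) signed_row signed_col ev).
Qed.

End Spectra.

Theorem theorem1p54 (R : realType) (G : double_cover) (k : int)
    (C : {set qnode G}) (O : qnode G -> G)
    (strongG : strong_grading G)
    (compC : up_component (k - 1) C)
    (nleafC : ~ single_leaf C)
    (ncohC : ~ up_coherent C)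
    (orO : orientation O) :
  let D := nodes_above k C in
  let Aup := principal C (@A_up R G) in
  let Adown := principal D (@A_down R G) in
  let AOup := principal (O @: C) (@AO_up R G O) in
  let AOdown := principal (O @: D) (@AO_down R G O) in
  let Pup := principal (lift_set C) (@up_walk R G) in
  let Pdown := principal (lift_set D) (@down_walk R G) in
  let rate := Num.max (lambda_max1 Aup) (- lambda_min AOup) in
  [/\ [/\ down_component k D, ~ single_root D & ~ down_coherent D],
      [/\ simple_eigenvalue Aup 1, simple_eigenvalue Adown 1,
          lambda_max1 Aup = lambda_max1 Adown & lambda_max1 Aup < 1],
      lambda_min AOup = lambda_min AOdown /\ -1 < lambda_min AOup,
      [/\ stochastic Pup, irreducible Pup & aperiodic Pup] /\
      [/\ stochastic Pdown, irreducible Pdown & aperiodic Pdown]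
    & convergence_rate Pup rate /\ convergence_rate Pdown rate].
Proof.
move=> D Aup Adown AOup AOdown Pup Pdown rate.
set B := incidence_mx R k C; set S := signed_incidence_mx R k C O.
have AupE : Aup = B *m B^T by apply: A_up_gram.
have AdownE : Adown = B^T *m B by apply: A_down_gram.
have AOupE : AOup = - (S *m S^T) by apply: AO_up_gram.
have AOdownE : AOdown = - (S^T *m S) by apply: AO_down_gram.
have C1 := card_upC nleafC ncohC orO.
have D1 : (1 < #|D|)%N by apply: card_above orO.
have lmax : lambda_max1 (B *m B^T) = lambda_max1 (B^T *m B) by apply: lambda_max1_gram.
have lmin := lambda_min_gram S.
have l1 : -1 < lambda_min (- (S *m S^T)) by apply: signed_lambda_min.
have S0 : S != 0 by apply: signed_neq0.
have wC0 := weight_row_neq0 R (ltnW C1); have wD0 := weight_row_neq0 R (ltnW D1).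
have wC := weight_row_up R strongG compC nleafC.
have wD := weight_row_down R strongG compC nleafC.
have unC := @up_eigenvector1 R _ _ _ strongG compC nleafC.
have unD := @down_eigenvector1 R _ _ _ strongG compC nleafC.
have leC := @up_eigenvalue_le1 R _ _ _ strongG compC nleafC.
have leD := @down_eigenvalue_le1 R _ _ _ strongG compC nleafC.
have symC : (B *m B^T)^T = B *m B^T := gram_sym B.
have symD : (B^T *m B)^T = B^T *m B by rewrite trmx_mul trmxK.
have muC : mup 1 (char_poly (B *m B^T)) = 1%N.
  by apply: (simple_mup symC wC0); rewrite ?scale1r // => f; rewrite scale1r; apply: unC.
have muD : mup 1 (char_poly (B^T *m B)) = 1%N.
  by apply: (simple_mup symD wD0); rewrite ?scale1r // => f; rewrite scale1r; apply: unD.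
have [lt1 _ _] := lambda_max1_lt symC C1 leC muC.
have [s1 i1 a1 c1] : [/\ stochastic Pup, irreducible Pup, aperiodic Pup
    & convergence_rate Pup rate].
  rewrite /rate AupE AOupE; apply: (@lifted_walk _ _ _ orO C _ _ B S
    (@A_up R G) (@AO_up R G O) (@up_walk R G) (@path_weight R G)) => //.
  - exact: AO_up_oddl.
  - exact: AO_up_oddr.
  - exact: path_weight_gt0.
  - exact: up_walk_ge0.
  - by move=> u v uC vC; apply: (@up_walkE _ _ k C).
have [s2 i2 a2 c2] : [/\ stochastic Pdown, irreducible Pdown, aperiodic Pdown
    & convergence_rate Pdown rate].
  (* The rate is rewritten in terms of the transposed incidence matrices, so the argument for the
     up-walk applies to [D] with B^T and S^T. *)
  rewrite /rate AupE AOupE lmax lmin -{2}[B]trmxK -{2}[S]trmxK.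
  apply: (@lifted_walk _ _ _ orO D _ _ B^T S^T
    (@A_down R G) (@AO_down R G O) (@down_walk R G) (@path_weight R G));
    rewrite ?trmxK //.
  - exact: AO_down_oddl.
  - exact: AO_down_oddr.
  - exact: path_weight_gt0.
  - by rewrite -trmx0 (inj_eq trmx_inj).
  - by rewrite -lmin.
  - exact: down_walk_ge0.
  - by move=> u v uD vD; apply: (@down_walkE _ _ k C).
split.
- split; [exact: above_component|exact: above_nsingle_root|].
  exact: (above_ncoherent strongG compC nleafC ncohC orO).
- rewrite AupE AdownE; split=> //; split=> //; apply/eigenvalueP.
    by exists (weight_row R C); rewrite ?scale1r.
  by exists (weight_row R D); rewrite ?scale1r.
- by rewrite AOupE AOdownE lmin -lmin.
- by [].
- by [].
Qed.
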